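(* Let $(X,\mathcal A,\nu)$ be a $\sigma$-finite standard measure space, let $R$ be a symmetric positive operator acting in $L^2(\nu)$ satisfying assumptions (i)--(iv) of the context, and let $\widehat R$ be the Friedrichs extension of $R$. Denote by $\lambda=\lambda(R)$ the symmetric measure on $X\times X$ defined by $\lambda(A\times B)=\int_X\chi_AR(\chi_B)\,d\nu$. Then $$K(A,B):=\lambda(A\times B),\qquad A,B\in\mathcal D(\nu),$$ is a positive definite function defined on the set $\mathcal D(\nu)$ and generates the reproducing kernel Hilbert space $\mathcal H(\lambda)$. The elements $\widehat f(A)$ of $\mathcal H(\lambda)$ are signed measures on $\mathcal D(\nu)$ which are defined by the formula $$\widehat f(A)=\int_XR(x,A)f(x)\,d\nu(x)=\langle R(\chi_A),f\rangle_{L^2(\nu)},$$ where $f\in Dom(\widehat R^{1/2})$. They are absolutely continuous with respect to $\nu$ and $$\frac{d\widehat f}{d\nu}=R(f).$$ Moreover, $$\|\widehat R^{1/2}(f)\|_{L^2(\nu)}=\|\widehat f\|_{\mathcal H(\lambda)},$$ and therefore the map $\widehat R^{1/2}(Dom(\widehat R^{1/2}))\ni\widehat R^{1/2}(f)\longmapsto\widehat f\in\mathcal H(\lambda)$ is an isometric isomorphism between these Hilbert spaces.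
   Context: All spaces are real. $\mathcal D(\nu)=\{A\in\mathcal A:\nu(A)<\infty\}$, and $\mathcal F(\nu)$ is the linear span of $\{\chi_A:A\in\mathcal D(\nu)\}$. $R(x,A):=R(\chi_A)(x)$. Assumptions on $R$: (i) $R$ is a densely defined (in general unbounded) operator in $L^2(\nu)$ with $\mathcal F(\nu)\subset Dom(R)$ and $R(\mathcal F(\nu))\subset L^2(\nu)$; (ii) $R$ is symmetric and positive, i.e. $R(f)\ge0$ whenever $f\ge0$; (iii) $R$ is positive definite, i.e. $\langle R(f),f\rangle_{L^2(\nu)}\ge0$; (iv) the kernel of $R$ is trivial. The space $\widehat R^{1/2}(Dom(\widehat R^{1/2}))$ carries the inner product $\langle\widehat R^{1/2}f,\widehat R^{1/2}g\rangle_{L^2(\nu)}$. A function $K:S\times S\to\mathbb R$ is positive definite if $\sum_{i,j}\alpha_i\alpha_jK(s_i,s_j)\ge0$ for all finite families $s_i\in S$, $\alpha_i\in\mathbb R$. The reproducing kernel Hilbert space generated by $K$ is the completion of $\mathrm{span}\{K_s=K(s,\cdot):s\in S\}$ under the inner product $\langle\sum_i\alpha_iK_{s_i},\sum_j\beta_jK_{s_j}\rangle=\sum_{i,j}\alpha_i\beta_jK(s_i,s_j)$, realized as a space of functions on $S$ via $f(s)=\langle f,K_s\rangle$. Here $S=\mathcal D(\nu)$ and the space is denoted $\mathcal H(\lambda)$.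
   Formalization: Norm identity and isomorphism assume F(ν) is a form core of R; the isomorphism is from the closure of the range of R̂^{1/2} (the range itself if complete); in general the f̂ are only dense in H(λ); off Dom(R), Dom(R̂), R(f) is the monotone-limit action of R. *)

(* Defs.v *)
From HB Require Import structures.
From mathcomp Require Import all_boot all_order all_algebra.
From mathcomp Require Import all_classical all_reals all_analysis measurable_realfun.
Import Order.TTheory GRing.Theory Num.Theory.
Import numFieldNormedType.Exports.

Set Implicit Arguments.
Unset Strict Implicit.
Unset Printing Implicit Defensive.

Local Open Scope classical_set_scope.
Local Open Scope ring_scope.

(* Standard Borel space: measurably isomorphic to a Polish space (a second
   countable Hausdorff complete pseudometric space) with its Borel sets. *)
Definition standard_borel (R : realType) d (X : measurableType d) : Prop :=
  exists (Y : completePseudoMetricType R) (g : X -> Y),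
    [/\ hausdorff_space Y, @second_countable Y, bijective g
      & @measurable d X = [set g @^-1` B | B in <<s (@open Y) >>]].

(* Elements are functions, not classes: "equal in L^2" is = %[ae nu]. *)
Notation L2 nu := (LfunType nu (lee1n 2)).

Section SquareIntegrable.
Context d (X : measurableType d) (R : realType).
Variable nu : {measure set X -> \bar R}.

Local Notation L2 := (L2 nu).

Definition ip (f g : L2) : R := \int[nu]_x (f x * g x).

Definition sqn (f : L2) : R := ip f f.

Definition L2norm (f : L2) : R := Num.sqrt (sqn f).

Definition L2_cvg (u : nat -> L2) (f : L2) : Prop :=
  (fun n => sqn (u n - f)) @ \oo --> (0 : R).

Definition L2_cauchy (u : nat -> L2) : Prop :=
  forall e : R, 0 < e -> exists N, forall m n, (N <= m)%N -> (N <= n)%N ->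
    sqn (u m - u n) < e.

Definition L2_closure (V : set L2) : set L2 :=
  [set f | forall e : R, 0 < e -> exists2 g, V g & sqn (f - g) < e].

(* The range of an injective self-adjoint operator is dense but need not be
   complete, as for diag(1/n) on l^2. *)
Definition L2_complete (V : set L2) : Prop :=
  forall u : nat -> L2, (forall n, V (u n)) -> L2_cauchy u ->
    exists2 f, V f & L2_cvg u f.

Definition Dfin : set (set X) :=
  [set A | measurable A /\ (nu A < +oo)%E].

Lemma indic_Lfun2 (A : Dfin) : \1_(\val A) \in Lfun nu 2%:R%:E.
Proof.
have [mA finA] : Dfin (\val A) by exact: set_valP.
apply/andP; split; rewrite inE /=; first exact/measurable_indicP.
rewrite /finite_norm unlock /=.
apply: poweR_lty.
rewrite (_ : (\int[nu]_x _)%E = nu (\val A)) //.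
rewrite -[in RHS](setIT (\val A)) -integral_indic //.
apply: eq_integral => x _; rewrite /= indicE.
by case: (x \in _); rewrite ?normr1 ?normr0 ?powR1 ?powR0.
Qed.

Definition chi (A : Dfin) : L2 := Lfun_Sub (lee1n 2) (indic_Lfun2 A).

Definition Fspan : set L2 :=
  [set f | exists c : seq (R * Dfin), f = \sum_(p <- c) p.1 *: chi p.2].

(* Operators with domain. The domain and the operator are compatible with a.e.
   equality. Values outside the domain are irrelevant. *)
Record operator := Operator {
  dom : set L2;
  app :> L2 -> L2;
  dom0 : dom 0;
  dom_lin : forall a f g, dom f -> dom g -> dom (a *: f + g);
  dom_ae : forall f g : L2, f = g %[ae nu] -> dom f -> dom g;
  app_lin : forall a f g, dom f -> dom g ->
    app (a *: f + g) = a *: app f + app g %[ae nu];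
  app_ae : forall f g : L2, f = g %[ae nu] -> dom f ->
    app f = app g %[ae nu] }.

Implicit Types (T S : operator).

Definition graph T (f h : L2) : Prop := dom T f /\ T f = h %[ae nu].

Definition ran T : set L2 := [set g | exists f, graph T f g].

Definition densely_defined T : Prop := forall f : L2, L2_closure (dom T) f.

(* The graph of the adjoint, for densely defined T. *)
Definition adjoint_graph T (f h : L2) : Prop :=
  forall u, dom T u -> ip (T u) f = ip u h.

Definition symmetric T : Prop :=
  forall f g, dom T f -> dom T g -> ip (T f) g = ip f (T g).

Definition positivity_preserving T : Prop :=
  forall f, dom T f -> {ae nu, forall x, 0 <= f x} ->
    {ae nu, forall x, 0 <= T f x}.

Definition positive_op T : Prop := forall f, dom T f -> 0 <= ip (T f) f.

Definition trivial_kernel T : Prop := forall f, graph T f 0 -> f = 0 %[ae nu].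

Definition self_adjoint T : Prop :=
  densely_defined T /\ forall f h, graph T f h <-> adjoint_graph T f h.

(* Domain of the closure of the quadratic form <T f, f>. *)
Definition form_dom T : set L2 :=
  [set f | exists u : nat -> L2,
    [/\ forall n, dom T (u n), L2_cvg u f
      & forall e : R, 0 < e -> exists N, forall m n,
          (N <= m)%N -> (N <= n)%N ->
          ip (T (u m - u n)) (u m - u n) < e]].

(* That is the restriction of the adjoint of T to the domain of the closed
   form. *)
Definition friedrichs_extension T That : Prop :=
  forall f h, graph That f h <-> form_dom T f /\ adjoint_graph T f h.

(* S is the positive self-adjoint operator with S^2 = T, domains included. *)
Definition is_sqrt S T : Prop :=
  [/\ self_adjoint S, positive_op S
    & forall f h, graph T f h <-> dom S f /\ graph S (S f) h].

(* V is a core of the form <T f, f>, with form norm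
   (|f|^2 + <T f, f>)^(1/2). This is automatic if every element of dom T is
   a.e. equal to one of V; if dom T is larger, the form closure of T may exceed
   that of its restriction to V, as for a non-Friedrichs self-adjoint
   extension. *)
Definition form_core (V : set L2) T : Prop :=
  [/\ V `<=` dom T
    & forall f, dom T f -> forall e : R, 0 < e ->
        exists2 g, V g & sqn (f - g) + ip (T (f - g)) (f - g) < e].

Record admissible T : Prop := Admissible {
  adm_dense : densely_defined T;
  adm_span : Fspan `<=` dom T;
  adm_sym : symmetric T;
  adm_pos : positivity_preserving T;
  adm_pd : positive_op T;
  adm_ker : trivial_kernel T }.

(* For f >= 0 a.e.: h is the a.e. limit of T (s n), where the s n >= 0 in Fspan
   increase a.e. to f. *)
Definition monotone_limit T (f h : X -> R) : Prop :=
  exists s : nat -> L2,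
    [/\ forall n, Fspan (s n),
        {ae nu, forall x, forall n, 0 <= s n x <= s n.+1 x},
        {ae nu, forall x, (fun n => s n x) @ \oo --> f x}
      & {ae nu, forall x, (fun n => T (s n) x) @ \oo --> h x}].

(* The pointwise action of a positivity preserving T on functions that need not
   be in its domain, as for integration against a positive kernel. *)
Definition pointwise_action T (f h : X -> R) : Prop :=
  measurable_fun setT h /\
  exists hp hm : X -> R,
    [/\ monotone_limit T f^\+ hp, monotone_limit T f^\- hm
      & h = hp \- hm %[ae nu]].

(* Countable additivity on the ring Dfin; the series converges for every order
   of the terms, so it converges absolutely. *)
Definition signed_measure_on (F : Dfin -> R) : Prop :=
  forall (A : nat -> Dfin) (B : Dfin),
    trivIset setT (fun n => \val (A n)) ->
    \val B = \bigcup_n \val (A n) ->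
    series (fun n => F (A n)) @ \oo --> F B.

Definition abs_continuous (F : Dfin -> R) : Prop :=
  forall A : Dfin, nu (\val A) = 0%E -> F A = 0.

Definition has_density (F : Dfin -> R) (h : X -> R) : Prop :=
  forall A : Dfin, nu.-integrable (\val A) (EFin \o h) /\
    F A = \int[nu]_(x in \val A) h x.

(* T (chi A) x is the function R(x, A) attached to the operator T. *)
Definition hat T (f : L2) : Dfin -> R :=
  fun A => \int[nu]_x (T (chi A) x * f x).

Definition is_symmetric_measure_of T
    (lambda : {measure set (X * X) -> \bar R}) : Prop :=
  (forall E, measurable E -> lambda ((fun p => (p.2, p.1)) @^-1` E) = lambda E)
  /\ forall A B : Dfin,
    lambda (\val A `*` \val B) = (\int[nu]_x (chi A x * T (chi B) x))%:E.

Definition kernel_of (lambda : {measure set (X * X) -> \bar R}) :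
    Dfin -> Dfin -> R :=
  fun A B => fine (lambda (\val A `*` \val B)).

End SquareIntegrable.

Section RKHS.
Variables (R : realType) (I : Type) (K : I -> I -> R).

(* A list of pairs (a, s) stands for the formal combination of the a K_s. *)
Implicit Types c : seq (R * I).

Definition comb_fun c : I -> R := fun t => \sum_(p <- c) p.1 * K p.2 t.

Definition comb_ip c1 c2 : R :=
  \sum_(p <- c1) \sum_(q <- c2) p.1 * q.1 * K p.2 q.2.

Definition comb_sub c1 c2 : seq (R * I) := c1 ++ [seq (- p.1, p.2) | p <- c2].

Definition positive_definite : Prop := forall c, 0 <= comb_ip c c.

Definition comb_cauchy (u : nat -> seq (R * I)) : Prop :=
  forall e : R, 0 < e -> exists N, forall m n, (N <= m)%N -> (N <= n)%N ->
    comb_ip (comb_sub (u m) (u n)) (comb_sub (u m) (u n)) < e.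

(* The element of the completion given by a Cauchy sequence u is realized as
   the function s |-> <u, K_s>. *)
Definition represents (u : nat -> seq (R * I)) (f : I -> R) : Prop :=
  comb_cauchy u /\ forall s, (fun n => comb_fun (u n) s) @ \oo --> f s.

Definition rkhs : set (I -> R) := [set f | exists u, represents u f].

(* The limit of the inner products of representing sequences; it does not depend
   on their choice when K is positive definite. *)
Definition rkhs_ip (f g : I -> R) : R :=
  get [set l | exists u v, [/\ represents u f, represents v g
    & (fun n => comb_ip (u n) (v n)) @ \oo --> l]].

Definition rkhs_sqn (f : I -> R) : R := rkhs_ip f f.

Definition rkhs_norm (f : I -> R) : R := Num.sqrt (rkhs_sqn f).

(* (H, ipH) is a Hilbert space of functions on I with reproducing kernel K. *)
Record reproducing_space (H : set (I -> R)) (ipH : (I -> R) -> (I -> R) -> R)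
    : Prop := ReproducingSpace {
  rs_0 : H (fun=> 0);
  rs_lin : forall a f g, H f -> H g -> H (fun s => a * f s + g s);
  rs_ip_lin : forall a f g h, H f -> H g -> H h ->
    ipH (fun s => a * f s + g s) h = a * ipH f h + ipH g h;
  rs_ip_sym : forall f g, H f -> H g -> ipH f g = ipH g f;
  rs_ip_ge0 : forall f, H f -> 0 <= ipH f f;
  rs_ip_eq0 : forall f, H f -> ipH f f = 0 -> f = (fun=> 0);
  rs_complete : forall u : nat -> I -> R, (forall n, H (u n)) ->
    (forall e : R, 0 < e -> exists N, forall m n, (N <= m)%N -> (N <= n)%N ->
      ipH (u m \- u n) (u m \- u n) < e) ->
    exists2 f, H f & (fun n => ipH (u n \- f) (u n \- f)) @ \oo --> (0 : R);
  rs_kernel : forall s, H (K s);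
  rs_comb_ip : forall c1 c2, ipH (comb_fun c1) (comb_fun c2) = comb_ip c1 c2;
  rs_reproducing : forall f s, H f -> f s = ipH f (K s);
  rs_dense : forall f, H f -> forall e : R, 0 < e ->
    exists c, ipH (f \- comb_fun c) (f \- comb_fun c) < e }.

End RKHS.

(* Phi induces a linear isometric bijection from the a.e. classes of V onto W. *)
Record isometric_isomorphism d (X : measurableType d) (R : realType)
    (nu : {measure set X -> \bar R}) (I : Type)
    (V : set (L2 nu)) (W : set (I -> R)) (ipW : (I -> R) -> (I -> R) -> R)
    (Phi : L2 nu -> I -> R) : Prop := IsometricIsomorphism {
  iso_into : forall g, V g -> W (Phi g);
  iso_lin : forall a g h, V g -> V h ->
    Phi (a *: g + h) = (fun s => a * Phi g s + Phi h s);
  iso_ip : forall g h, V g -> V h -> ipW (Phi g) (Phi h) = ip g h;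
  iso_inj : forall g h, V g -> V h ->
    (Phi g = Phi h <-> g = h %[ae nu]);
  iso_onto : forall F, W F -> exists2 g, V g & Phi g = F }.

(* Main.v *)
(* Write S for the square root of the Friedrichs extension of T. Since
   lambda(A * B) = <T chi_A, chi_B> = <S chi_A, S chi_B>, the kernel K is the
   Gram kernel of the vectors S chi_A of L2. For a Gram kernel with values in a
   complete space, g |-> (A |-> <g, S chi_A>) maps the closed span M of these
   vectors isometrically onto the reproducing kernel Hilbert space, and it kills
   the orthogonal complement of M. As <S f, S chi_A> = <f, T chi_A>, it sends
   S f to hat T f. Under the core hypothesis S f lies in M: the domain of S^2 is
   a core of S, the Friedrichs construction and closedness of S give
   approximation from dom T, and the core hypothesis from simple functions.
   For the densities, monotone convergence along simple functions s n increasing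
   to f >= 0 turns the integral of T (s n) over A, which is <T chi_A, s n>, into
   <T chi_A, f>; finiteness of the limit follows by sigma-finiteness. *)

Require Import Defs.
From HB Require Import structures.
From mathcomp Require Import all_boot all_order all_algebra.
From mathcomp Require Import all_classical all_reals all_analysis measurable_realfun.
From mathcomp Require Import ring lra zify.
Import Order.TTheory GRing.Theory Num.Theory.
Import numFieldNormedType.Exports.

Set Implicit Arguments.
Unset Strict Implicit.
Unset Printing Implicit Defensive.

Local Open Scope classical_set_scope.
Local Open Scope ring_scope.

(** * Semi-inner product spaces *)

Section RealFacts.
Variable R : realType.

Lemma cvg0P (a : nat -> R) :
  (forall n, 0 <= a n) ->
  (a @ \oo --> (0 : R)) <->
  (forall e, 0 < e -> exists N, forall n, (N <= n)%N -> a n < e).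
Proof.
move=> a0; split=> [/cvgrPdist_lt cv e e0|cv].
  have [N _ hN] := cv _ e0.
  by exists N => n /hN; rewrite sub0r normrN ger0_norm.
apply/cvgrPdist_lt => e e0; have [N hN] := cv _ e0.
by exists N => // n /hN; rewrite sub0r normrN ger0_norm.
Qed.

(** Cauchy-Schwarz bounds the square of an error, so convergence is stated in terms of squares; [k]
    will be a fixed squared norm. *)
Lemma cvg_sqr_le (a c : nat -> R) (l k : R) :
  (forall n, (a n - l) ^+ 2 <= c n * k) -> c @ \oo --> (0 : R) ->
  a @ \oo --> l.
Proof.
move=> ack c0; have ck : (fun n => Num.sqrt (c n * k)) @ \oo --> (0 : R).
  rewrite -(@sqrtr0 R) -(mul0r k).
  by apply: continuous_cvg; [exact: sqrt_continuous|exact: cvgMl].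
apply/cvgrPdist_lt => e e0; move/cvgrPdist_lt/(_ _ e0): ck.
apply: filterS => n; rewrite sub0r normrN ger0_norm ?sqrtr_ge0//.
apply: le_lt_trans; rewrite distrC -sqrtr_sqr ler_sqrt //.
exact: le_trans (sqr_ge0 _) (ack n).
Qed.

(** First-order optimality: the quadratic vanishes at [t = 0], which is then a minimum, so its slope
    there is zero. This is how orthogonality is extracted from minimality. *)
Lemma quadratic_ge0_lin0 (p c : R) :
  (forall t, 0 <= t ^+ 2 * c - 2 * t * p) -> p = 0.
Proof.
move=> h.
(* With [r] positive and at least [c], the value at [t = p / r] is [p ^+ 2] times the negative
   number [c - 2 * r], over [r ^+ 2]. *)
pose r := `|c| + 1; have r0 : 0 < r by rewrite ltr_wpDl.
have cr : c <= r by rewrite (le_trans (ler_norm c)) // lerDl.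
have /(_ (p / r)) := h => hp.
have : 0 <= p ^+ 2 * (c - 2 * r) / r ^+ 2.
  apply: le_trans hp _; rewrite le_eqVlt; apply/orP; left; apply/eqP.
  by field; rewrite gt_eqF.
rewrite pmulr_lge0 ?invr_gt0 ?exprn_gt0 // => {}hp.
have : p ^+ 2 <= 0.
  have : 0 < 2 * r - c by lra.
  by move=> s0; rewrite -(pmulr_lle0 _ s0); lra.
by rewrite le_eqVlt ltNge sqr_ge0 orbF sqrf_eq0 => /eqP.
Qed.

End RealFacts.

Section SemiInnerProduct.
Variables (R : realType) (V : lmodType R) (b : V -> V -> R).
Implicit Types (x y z : V) (u v : nat -> V) (W : set V).

(** Definiteness is left out: elements of [L2] are functions, not classes, so a nonzero vector can
    have norm zero. *)
Record semi_inner : Prop := SemiInner {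
  si_lin : forall a x y z, b (a *: x + y) z = a * b x z + b y z;
  si_sym : forall x y, b x y = b y x;
  si_ge0 : forall x, 0 <= b x x }.

Definition si_cvg u x := (fun n => b (u n - x) (u n - x)) @ \oo --> (0 : R).

Definition si_cauchy u := forall e : R, 0 < e -> exists N, forall m n,
  (N <= m)%N -> (N <= n)%N -> b (u m - u n) (u m - u n) < e.

Definition si_complete := forall u, si_cauchy u -> exists x, si_cvg u x.

Definition si_closure W : set V :=
  [set x | forall e : R, 0 < e -> exists2 w, W w & b (x - w) (x - w) < e].

Definition subspace W :=
  W 0 /\ forall a x y, W x -> W y -> W (a *: x + y).

Hypothesis bP : semi_inner.

Let bC x y : b x y = b y x. Proof. exact: si_sym. Qed.
Let b_ge0 x : 0 <= b x x. Proof. exact: si_ge0. Qed.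

Lemma siDl x y z : b (x + y) z = b x z + b y z.
Proof. by rewrite -[x]scale1r si_lin// mul1r scale1r. Qed.

Lemma si0l z : b 0 z = 0.
Proof. by apply: (addIr (b 0 z)); rewrite -siDl addr0 add0r. Qed.

Lemma siZl a x z : b (a *: x) z = a * b x z.
Proof. by rewrite -[_ *: _]addr0 si_lin// si0l addr0. Qed.

Lemma siNl x z : b (- x) z = - b x z.
Proof. by rewrite -scaleN1r siZl mulN1r. Qed.

Lemma siDr x y z : b z (x + y) = b z x + b z y.
Proof. by rewrite ![b z _]bC siDl. Qed.

Lemma siZr a x z : b z (a *: x) = a * b z x.
Proof. by rewrite ![b z _]bC siZl. Qed.

Lemma siNr x z : b z (- x) = - b z x.
Proof. by rewrite ![b z _]bC siNl. Qed.

Lemma si0r z : b z 0 = 0. Proof. by rewrite bC si0l. Qed.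

Definition siE := (siDl, siDr, siNl, siNr, siZl, siZr, si0l, si0r).

Lemma siBC x y : b (x - y) (x - y) = b (y - x) (y - x).
Proof. by rewrite !siE; ring. Qed.

Lemma si_suml (I : Type) (r : seq I) (F : I -> V) z :
  b (\sum_(i <- r) F i) z = \sum_(i <- r) b (F i) z.
Proof.
elim: r => [|i r IH]; first by rewrite !big_nil si0l.
by rewrite !big_cons siDl IH.
Qed.

Lemma si_sumr (I : Type) (r : seq I) (F : I -> V) z :
  b z (\sum_(i <- r) F i) = \sum_(i <- r) b z (F i).
Proof. by rewrite bC si_suml; apply: eq_bigr => i _; rewrite bC. Qed.

(** A null vector need not be zero, but nonnegativity of the form at [t *: x - y] for all [t] makes
    it orthogonal to everything. *)
Lemma si_orth x y : b y y = 0 -> b x y = 0.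
Proof.
move=> y0; apply: (@quadratic_ge0_lin0 _ _ (b x x)) => t.
by have := b_ge0 (t *: x - y); rewrite !siE y0 (bC y x); lra.
Qed.

Lemma si_cauchy_schwarz x y : b x y ^+ 2 <= b x x * b y y.
Proof.
have [y0|] := eqVneq (b y y) 0; first by rewrite si_orth// expr0n mulr_ge0.
rewrite neq_lt ltNge b_ge0 /= => y0.
(* This is the component of [x] orthogonal to [y], multiplied by [b y y] to avoid a division. *)
have := b_ge0 (b y y *: x - b x y *: y); rewrite !siE (bC y x) => h.
have {h} : 0 <= b y y * (b x x * b y y - b x y ^+ 2).
  by apply: le_trans h _; lra.
by rewrite pmulr_rge0// subr_ge0.
Qed.

(** Replaces the triangle inequality for squared norms; the factors 2 account for the [e / 4] in
    later estimates. *)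
Lemma siB_le x y z :
  b (x - z) (x - z) <= 2 * b (x - y) (x - y) + 2 * b (y - z) (y - z).
Proof.
have := b_ge0 ((x - y) - (y - z)).
by rewrite !siE (bC y x) (bC z x) (bC z y); lra.
Qed.

Lemma si_cvgP u x : si_cvg u x <->
  forall e, 0 < e -> exists N, forall n, (N <= n)%N ->
    b (u n - x) (u n - x) < e.
Proof. exact: cvg0P. Qed.

Lemma si_cvg_cauchy u x : si_cvg u x -> si_cauchy u.
Proof.
move=> /si_cvgP ux e e0; have e4 : 0 < e / 4 by lra.
have [N hN] := ux _ e4; exists N => m n /hN hm /hN hn.
apply: le_lt_trans (siB_le _ x _) _.
by rewrite [b (x - _) _]siBC; lra.
Qed.

Lemma si_cvg_cst x : si_cvg (fun=> x) x.
Proof. by apply/si_cvgP => e e0; exists 0%N => n _; rewrite subrr si0l. Qed.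

Lemma si_cvg_lin a u v x y : si_cvg u x -> si_cvg v y ->
  si_cvg (fun n => a *: u n + v n) (a *: x + y).
Proof.
move=> ux vy; apply: (@squeeze_cvgr _ _ _ _ (fun=> 0)
  (fun n => 2 * (a ^+ 2 * b (u n - x) (u n - x)) + 2 * b (v n - y) (v n - y))).
- apply: nearW => n; rewrite b_ge0 /=.
  have -> : a *: u n + v n - (a *: x + y) = a *: (u n - x) + (v n - y).
    by rewrite scalerBr opprD addrACA.
  have := siB_le (a *: (u n - x)) 0 (- (v n - y)).
  by rewrite opprK subr0 add0r siZl siZr => /le_trans; apply; lra.
- exact: cvg_cst.
- rewrite (_ : 0 = 2 * (a ^+ 2 * 0) + 2 * 0 :> R); last by ring.
  by apply: cvgD; [apply: cvgMr; exact: cvgMr|exact: cvgMr].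
Qed.

Lemma si_cvgl u x y : si_cvg u x -> (fun n => b (u n) y) @ \oo --> b x y.
Proof.
move=> ux; apply: (cvg_sqr_le _ ux (k := b y y)) => n.
by rewrite -siNl -siDl; exact: si_cauchy_schwarz.
Qed.

Lemma si_cvgM u v x y : si_cvg u x -> si_cvg v y ->
  (fun n => b (u n) (v n)) @ \oo --> b x y.
Proof.
move=> ux vy.
(* Only the product of the two errors needs Cauchy-Schwarz on both factors; the rest of the bilinear
   expansion is covered by [si_cvgl]. *)
have uvxy : (fun n => b (u n - x) (v n - y)) @ \oo --> (0 : R).
  apply: (@cvg_sqr_le _ _ (fun n =>
    b (u n - x) (u n - x) * b (v n - y) (v n - y)) _ 1) => [n|].
    by rewrite subr0 mulr1 si_cauchy_schwarz.
  by rewrite -[0](mulr0 0); exact: cvgM.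
rewrite [X in X @ _](_ : _ = fun n =>
    b (u n - x) (v n - y) + b (u n) y + b (v n) x - b x y); last first.
  by apply/funext => n; rewrite !siE (bC (v n) x); ring.
rewrite [X in _ --> X](_ : _ = 0 + b x y + b y x - b x y); last first.
  by rewrite (bC y x); ring.
apply: cvgB; last exact: cvg_cst.
by apply: cvgD; [apply: cvgD; [exact: uvxy|exact: si_cvgl]|exact: si_cvgl].
Qed.

Lemma si_closureP W x :
  si_closure W x <-> exists2 u, (forall n, W (u n)) & si_cvg u x.
Proof.
split=> [Wx|[u Wu /si_cvgP ux] e e0]; last first.
  by have [N hN] := ux _ e0; exists (u N); rewrite // siBC hN.
have /choice[u hu] n : exists w, W w /\ b (x - w) (x - w) < n.+1%:R^-1.
  by have [|w] := Wx n.+1%:R^-1; [rewrite invr_gt0|exists w].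
exists u => [n|]; first by case: (hu n).
apply: (@squeeze_cvgr _ _ _ _ (fun=> 0) (fun n => n.+1%:R^-1)).
- apply: nearW => n; rewrite b_ge0 /= siBC ltW//; exact: (hu n).2.
- exact: cvg_cst.
- exact: cvg_harmonic.
Qed.

Lemma sub_si_closure W : W `<=` si_closure W.
Proof. by move=> x Wx e e0; exists x; rewrite // subrr si0l. Qed.

Lemma si_closure_min W W' : W `<=` si_closure W' ->
  si_closure W `<=` si_closure W'.
Proof.
move=> WW' x Wx e e0; have e4 : 0 < e / 4 by lra.
have [w /WW' /(_ _ e4) [w' W'w' ww'] xw] := Wx _ e4; exists w' => //.
by apply: le_lt_trans (siB_le _ w _) _; lra.
Qed.

Lemma subspace_closure W : subspace W -> subspace (si_closure W).
Proof.
move=> [W0 WL]; split; first exact: sub_si_closure.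
move=> a x y /si_closureP[u Wu ux] /si_closureP[v Wv vy]; apply/si_closureP.
exists (fun n => a *: u n + v n); last exact: si_cvg_lin.
by move=> n; exact: WL.
Qed.

(** Orthogonality to [W] passes to limits from [W], hence to [x] itself. *)
Lemma si_closure_orth W x :
  (forall w, W w -> b x w = 0) -> si_closure W x -> b x x = 0.
Proof.
move=> xW /si_closureP[u Wu ux].
have := si_cvgl (y := x) ux.
under eq_fun do rewrite bC xW//.
by move=> /(cvg_lim (@Rhausdorff R)) <-; rewrite lim_cst.
Qed.

(** The projection theorem: a minimizing sequence for the distance from [x] to [W] is Cauchy, and
    minimality at its limit gives orthogonality. *)
Lemma si_projection W x : si_complete -> subspace W ->
  exists2 m, si_closure W m & forall w, W w -> b (x - m) w = 0.
Proof.
move=> Vc [W0 WL].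
pose D := [set b (x - w) (x - w) | w in W]; pose dl := inf D.
have Dinf : has_inf D.
  by split; [exists (b (x - 0) (x - 0)); exists 0|exists 0 => _ [w _ <-]].
have dl_le w : W w -> dl <= b (x - w) (x - w).
  by move=> Ww; apply: ge_inf; [case: Dinf|exists w].
have /choice[u hu] n : exists w, W w /\ b (x - w) (x - w) < dl + n.+1%:R^-1.
  have [|_ [w Ww <-] hw] := inf_adherent (eps := n.+1%:R^-1) _ Dinf.
    by rewrite invr_gt0.
  by exists w.
(* The parallelogram identity at the midpoint of u m and u n. *)
have uc : si_cauchy u.
  move=> e e0; have e4 : 0 < e / 4 by lra.
  have [|+ _] := @cvg0P R harmonic; first by move=> n; exact: harmonic_ge0.
  move=> /(_ cvg_harmonic _ e4)[N hN].
  exists N => m n /hN /= hm /hN /= hn.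
  have [Wm um] := hu m; have [Wn un] := hu n.
  have := dl_le (2^-1 *: u m + 2^-1 *: u n).
  have /[swap]/[apply] : W (2^-1 *: u m + 2^-1 *: u n).
    by apply: (WL) => //; rewrite -[_ *: _]addr0; exact: WL.
  move: um un; rewrite !siE (bC (u n) (u m)) (bC (u n) x) (bC (u m) x).
  move: hm hn; move: (m.+1%:R^-1) (n.+1%:R^-1) => p q.
  by lra.
have [m um] := Vc _ uc; exists m.
  by apply/si_closureP; exists u => // n; case: (hu n).
(* Comparing [u n], optimal up to [n.+1%:R^-1], with its perturbation [u n + t *: w] bounds the
   sequence in [cv] below by 0; the limit is the required quadratic. *)
move=> w Ww; apply: (@quadratic_ge0_lin0 _ _ (b w w)) => t.
have cv : (fun n => n.+1%:R^-1 - 2 * t * b (x - u n) w + t ^+ 2 * b w w)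
    @ \oo --> 0 - 2 * t * b (x - m) w + t ^+ 2 * b w w.
  apply: cvgD; last exact: cvg_cst.
  apply: cvgB; first exact: cvg_harmonic.
  apply: cvgMr; rewrite siDl siNl.
  under eq_fun do rewrite siDl siNl.
  by apply: cvgB; [exact: cvg_cst|exact: si_cvgl].
have := limr_ge (cvgP _ cv) (x := 0); rewrite (cvg_lim _ cv)//.
rewrite sub0r [leRHS]addrC; apply; apply: nearW => n; have [Wn un] := hu n.
have : W (u n + t *: w) by rewrite addrC; exact: WL.
move/dl_le; move: un; rewrite !siE (bC w x) (bC (u n) x) (bC w (u n)).
by move: (n.+1%:R^-1) => p; lra.
Qed.

End SemiInnerProduct.

(** * Gram kernels and self-adjoint graphs *)

Section GramKernel.
Variables (R : realType) (V : lmodType R) (b : V -> V -> R).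
Hypotheses (bP : semi_inner b) (Vc : si_complete b).
Variables (I : Type) (k : I -> V) (K : I -> I -> R).
Hypothesis KE : forall s t, K s t = b (k s) (k t).
Implicit Types (c : seq (R * I)) (g h : V).

Definition feature_comb c : V := \sum_(p <- c) p.1 *: k p.2.

Definition feature_closure : set V := si_closure b (range feature_comb).

Definition feature_eval g : I -> R := fun s => b g (k s).

Local Notation v := feature_comb.
Local Notation M := feature_closure.
Local Notation ev := feature_eval.

Let bC x y : b x y = b y x. Proof. exact: si_sym. Qed.

Lemma feature_comb_cat c1 c2 : v (c1 ++ c2) = v c1 + v c2.
Proof. exact: big_cat. Qed.

Lemma feature_combZ a c : v [seq (a * p.1, p.2) | p <- c] = a *: v c.
Proof.
by rewrite /v big_map scaler_sumr; apply: eq_bigr => p _; rewrite scalerA.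
Qed.

Lemma feature_comb_sub c1 c2 : v (comb_sub c1 c2) = v c1 - v c2.
Proof.
rewrite feature_comb_cat /v big_map -sumrN; congr (_ + _).
by apply: eq_bigr => p _; rewrite scaleNr.
Qed.

Lemma comb_ipE c1 c2 : comb_ip K c1 c2 = b (v c1) (v c2).
Proof.
rewrite (si_suml bP); apply: eq_bigr => p _; rewrite (si_sumr bP).
by apply: eq_bigr => q _; rewrite (siZl bP) (siZr bP) KE; ring.
Qed.

Lemma comb_funE c : comb_fun K c = ev (v c).
Proof.
apply/funext => t; rewrite /ev (si_suml bP).
by apply: eq_bigr => p _; rewrite (siZl bP) KE.
Qed.

Lemma gram_positive_definite : positive_definite K.
Proof. by move=> c; rewrite comb_ipE; exact: si_ge0. Qed.

Lemma range_feature_subspace : subspace (range v).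
Proof.
split; first by exists [::] => //; rewrite /v big_nil.
move=> a _ _ [c _ <-] [c' _ <-].
exists ([seq (a * p.1, p.2) | p <- c] ++ c') => //.
by rewrite feature_comb_cat feature_combZ.
Qed.

Lemma feature_closure_lin a g h : M g -> M h -> M (a *: g + h).
Proof. exact: (subspace_closure bP range_feature_subspace).2. Qed.

Lemma feature_closureB g h : M g -> M h -> M (g - h).
Proof.
by move=> Mg Mh; rewrite addrC -scaleN1r; exact: feature_closure_lin.
Qed.

Lemma feature_combM c : M (v c).
Proof. by apply: sub_si_closure => //; exists c. Qed.

Lemma feature_evalB g h : ev (g - h) = ev g \- ev h.
Proof. by apply/funext => s; rewrite /ev (siDl bP) (siNl bP). Qed.

Lemma feature_eval_lin a g h :
  ev (a *: g + h) = (fun s => a * ev g s + ev h s).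
Proof. by apply/funext => s; exact: (si_lin bP). Qed.

Lemma feature_eval_eq g h : b (g - h) (g - h) = 0 -> ev g = ev h.
Proof.
move=> gh0; apply/funext => s; apply/eqP; rewrite -subr_eq0.
by rewrite -[_ - _]/((ev g \- ev h) s) -feature_evalB /ev bC si_orth.
Qed.

(** Equal evaluations make [g - h] orthogonal to every feature vector, while it lies in the closure
    of their span. *)
Lemma feature_eval_inj g h : M g -> M h ->
  ev g = ev h -> b (g - h) (g - h) = 0.
Proof.
move=> Mg Mh gh; apply: (si_closure_orth bP) (feature_closureB Mg Mh).
move=> _ [c _ <-]; rewrite (si_sumr bP) big1// => p _.
by rewrite (siZr bP) -[b _ _]/(ev _ _) feature_evalB gh /= subrr mulr0.
Qed.

(** The Gram form turns Cauchy sequences of formal combinations into Cauchy sequences of [V], whose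
    limits exist by completeness; an abstract completion becomes a set of vectors. *)
Lemma representsP (u : nat -> seq (R * I)) F :
  represents K u F <-> exists g, si_cvg b (fun n => v (u n)) g /\ F = ev g.
Proof.
split=> [[uc uF]|[g [ug ->]]].
  have [g ug] : exists g, si_cvg b (fun n => v (u n)) g.
    apply: Vc => e /uc[N hN]; exists N => m n Nm Nn.
    by rewrite -feature_comb_sub -comb_ipE; exact: hN.
  exists g; split=> //; apply/funext => s.
  rewrite -(cvg_lim (@Rhausdorff R) (uF s)).
  apply: cvg_lim => //; under eq_fun do rewrite comb_funE.
  exact: si_cvgl.
split=> [e e0|s]; last first.
  by under eq_fun do rewrite comb_funE; exact: si_cvgl.
have [N hN] := si_cvg_cauchy bP ug e0; exists N => m n Nm Nn.
by rewrite comb_ipE feature_comb_sub; exact: hN.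
Qed.

Lemma rkhsP F : rkhs K F <-> exists2 g, M g & F = ev g.
Proof.
split=> [[u /representsP[g [ug ->]]]|[g]].
  exists g => //; apply/si_closureP => //.
  by exists (fun n => v (u n)) => // n; exists (u n).
move=> /(si_closureP bP)[w /(_ _)/cid2-/all_sig2[u _ uw] wg] ->.
exists u; apply/representsP; exists g; split=> //.
by rewrite (_ : (fun _ => _) = w)//; apply/funext.
Qed.

Lemma feature_eval_rkhs g : M g -> rkhs K (ev g).
Proof. by move=> Mg; apply/rkhsP; exists g. Qed.

(** Projecting to [M] removes only a part orthogonal to all features. Hence [ev g] lies in the
    reproducing kernel space for every [g], in [M] or not. *)
Lemma feature_eval_rkhs_proj g :
  exists2 m, M m & ev g = ev m.
Proof.
have [m Mm mP] := si_projection bP g Vc range_feature_subspace.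
exists m => //; apply/funext => s; apply/eqP.
rewrite -subr_eq0 /ev -(siNl bP) -(siDl bP) mP//.
exists [:: (1, s)] => //.
by rewrite /v big_seq1 scale1r.
Qed.

Lemma rkhs_ipE g h : M g -> M h -> rkhs_ip K (ev g) (ev h) = b g h.
Proof.
move=> Mg Mh; rewrite /rkhs_ip; set L := [set _ | _].
(* Since [rkhs_ip] is a choice, [L] is shown to contain at most [b g h], then to be inhabited. Other
   representing sequences have limits differing from [g] and [h] by null vectors only. *)
have uniq l : L l -> l = b g h.
  move=> [u1 [u2 [/representsP[g' [ug' gg']] /representsP[h' [uh' hh']]]]].
  have Mg' : M g'.
    by apply/si_closureP => //; exists (v \o u1) => // n; exists (u1 n).
  have Mh' : M h'.
    by apply/si_closureP => //; exists (v \o u2) => // n; exists (u2 n).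
  have /(si_orth bP h) := feature_eval_inj Mg Mg' gg'.
  have /(si_orth bP g') := feature_eval_inj Mh Mh' hh'.
  rewrite !(siE bP) => hh'0 gg'0.
  under eq_fun do rewrite comb_ipE.
  move=> /(cvg_lim (@Rhausdorff R)) <-.
  rewrite (cvg_lim (@Rhausdorff R) (si_cvgM bP ug' uh')).
  by move: hh'0 gg'0; rewrite (bC h g) (bC h g'); lra.
apply: uniq; apply: getPex.
have [u1 ru1] := feature_eval_rkhs Mg; have [u2 ru2] := feature_eval_rkhs Mh.
have [g' [ug' _]] := (representsP _ _).1 ru1.
have [h' [uh' _]] := (representsP _ _).1 ru2.
exists (b g' h'), u1, u2; split=> //.
by under eq_fun do rewrite comb_ipE; exact: si_cvgM.
Qed.

Lemma feature_closure_complete (u : nat -> V) :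
  (forall n, M (u n)) -> si_cauchy b u -> exists2 g, M g & si_cvg b u g.
Proof.
move=> Mu /Vc[g ug]; exists g => //.
by apply: (si_closure_min bP (W := M)) => //; apply/si_closureP => //; exists u.
Qed.

(** Through [rkhsP] and [rkhs_ipE] each clause becomes a fact about [M], a closed subspace of a
    complete space. *)
Lemma gram_reproducing_space : reproducing_space K (rkhs K) (rkhs_ip K).
Proof.
have kM s : M (k s).
  rewrite -[k s]scale1r.
  rewrite -[_ *: _](big_seq1 +%R (1, s) (fun p => p.1 *: k p.2)).
  exact: feature_combM.
have KsE s : K s = ev (k s) by apply/funext => t; rewrite KE.
split.
- exists (fun=> [::]); apply/representsP; exists 0; split.
    by rewrite /v big_nil; exact: si_cvg_cst.
  by apply/funext => s; rewrite /ev (si0l bP).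
- move=> a _ _ /rkhsP[g Mg ->] /rkhsP[h Mh ->]; rewrite -feature_eval_lin.
  exact/feature_eval_rkhs/feature_closure_lin.
- move=> a _ _ _ /rkhsP[g Mg ->] /rkhsP[h Mh ->] /rkhsP[l Ml ->].
  rewrite -feature_eval_lin !rkhs_ipE ?(si_lin bP)//.
  exact: feature_closure_lin.
- by move=> _ _ /rkhsP[g Mg ->] /rkhsP[h Mh ->]; rewrite !rkhs_ipE.
- by move=> _ /rkhsP[g Mg ->]; rewrite rkhs_ipE//; exact: si_ge0.
- move=> _ /rkhsP[g Mg ->]; rewrite rkhs_ipE// => g0.
  by apply/funext => s; rewrite /ev bC si_orth.
- move=> u /(_ _)/rkhsP/cid2-/all_sig2[w Mw uw] uc.
  have [e e0|g Mg wg] := feature_closure_complete Mw.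
    have [N hN] := uc _ e0; exists N => m n Nm Nn.
    have := hN _ _ Nm Nn; rewrite !uw -feature_evalB.
    by rewrite rkhs_ipE//; exact: feature_closureB.
  exists (ev g); first exact: feature_eval_rkhs.
  rewrite (_ : (fun _ => _) = fun n => b (w n - g) (w n - g))//.
  apply/funext => n; rewrite uw -feature_evalB rkhs_ipE//;
  exact: feature_closureB.
- by move=> s; rewrite KsE; exact: feature_eval_rkhs.
- move=> c1 c2; rewrite !comb_funE rkhs_ipE ?comb_ipE//.
  + exact: feature_combM.
  + exact: feature_combM.
- by move=> _ s /rkhsP[g Mg ->]; rewrite KsE rkhs_ipE.
- move=> _ /rkhsP[g Mg ->] e e0.
  have [_ [c _ <-] gc] := Mg _ e0; exists c.
  rewrite comb_funE -feature_evalB rkhs_ipE//;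
  by apply: feature_closureB => //; exact: feature_combM.
Qed.

End GramKernel.

(** * Self-adjoint graphs: closedness, resolvent and the core given by the square *)

Section SelfAdjointRelation.
Variables (R : realType) (V : lmodType R) (b : V -> V -> R).
Hypotheses (bP : semi_inner b) (Vc : si_complete b).

(** On a graph, its diagonal is the squared graph norm. *)
Definition prod_ip (x y : V * V) : R := b x.1 y.1 + b x.2 y.2.

Lemma prod_semi_inner : semi_inner prod_ip.
Proof.
split=> [a [x x'] [y y'] [z z']|[x x'] [y y']|[x x']]; rewrite /prod_ip /=.
- by rewrite !(si_lin bP); ring.
- by rewrite !(si_sym bP x) !(si_sym bP x').
- by rewrite addr_ge0// si_ge0.
Qed.

Lemma prod_complete : si_complete prod_ip.
Proof.
have H u : si_cauchy prod_ip u ->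
    si_cauchy b (fst \o u) /\ si_cauchy b (snd \o u).
  move=> uc; split=> e /uc[N hN]; exists N => m n Nm Nn; have := hN _ _ Nm Nn;
    rewrite /prod_ip; apply: le_lt_trans => /=.
    by rewrite lerDl; exact: si_ge0.
  by rewrite lerDr; exact: si_ge0.
move=> u /H[/Vc[x ux] /Vc[y uy]]; exists (x, y).
rewrite /si_cvg -[0](addr0 0); exact: cvgD.
Qed.

(* G is the graph of a self-adjoint operator. Graphs absorb the difference
   between equality and equality up to a vector of norm zero. *)
Variable G : set (V * V).
Hypothesis Gsa : forall x y,
  G (x, y) <-> forall u v, G (u, v) -> b v x = b u y.
Hypothesis Gdense : forall x, si_closure b [set u | exists v, G (u, v)] x.

Lemma sa_sym x y u v : G (x, y) -> G (u, v) -> b v x = b u y.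
Proof. by move=> /Gsa; exact. Qed.

Lemma sa_subspace : subspace G.
Proof.
split; first by apply/Gsa => u v _; rewrite !(si0r bP).
move=> a [x y] [x' y'] Gx Gx'; apply/Gsa => u v Gu.
by rewrite !(siDr bP) !(siZr bP) (sa_sym Gx Gu) (sa_sym Gx' Gu).
Qed.

Lemma sa_sub x y u v : G (x, y) -> G (u, v) -> G (u - x, v - y).
Proof.
move=> Gx Gu; have := sa_subspace.2 (-1) _ _ Gx Gu.
rewrite (_ : _ + _ = (u - x, v - y))//.
by congr (_, _); rewrite /= scaleN1r addrC.
Qed.

(** Self-adjointness says that [G] is the orthogonal complement of the rotated pairs [(v, - u)] with
    [(u, v)] in [G], and orthogonal complements are closed. *)
Lemma sa_closed x y : si_closure prod_ip G (x, y) -> G (x, y).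
Proof.
move=> /(si_closureP prod_semi_inner)[w Gw wxy]; apply/Gsa => u v Guv.
apply/eqP; rewrite -subr_eq0.
have := si_cvgl prod_semi_inner (y := (v, - u)) wxy.
under eq_fun => n.
  have -> : prod_ip (w n) (v, - u) = 0.
    have := Gw n; case: (w n) => p q Gpq.
    rewrite /prod_ip (siNr bP) /= (si_sym bP p) (sa_sym Gpq Guv).
    by rewrite (si_sym bP u) subrr.
  over.
move=> /(cvg_lim (@Rhausdorff R)); rewrite lim_cst// => /esym.
by rewrite /prod_ip (siNr bP) /= (si_sym bP x) (si_sym bP y) => ->.
Qed.

(** [G] is single-valued up to null vectors: by symmetry [y] is orthogonal to the dense domain. *)
Lemma sa_kernel0 y : G (0, y) -> b y y = 0.
Proof.
move=> Gy; apply: (si_closure_orth bP) (Gdense y) => u [v Guv].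
by rewrite (si_sym bP) -(sa_sym Gy Guv) (si0r bP).
Qed.

(** Completeness gives some limit of [v], closedness puts it over [x], and single-valuedness
    identifies it with [y] up to a null vector. *)
Lemma sa_cvg (u v : nat -> V) x y : G (x, y) -> (forall n, G (u n, v n)) ->
  si_cvg b u x -> si_cauchy b v -> si_cvg b v y.
Proof.
move=> Gxy Guv ux vc; have [z vz] := Vc vc.
have Gxz : G (x, z).
  apply: sa_closed; apply/(si_closureP prod_semi_inner).
  exists (fun n => (u n, v n)) => //.
  by rewrite /si_cvg -[0](addr0 0); exact: cvgD.
have /sa_kernel0 zy0 : G (0, z - y).
  by rewrite -(subrr x); exact: sa_sub.
apply/(si_cvgP bP) => e e0; have e2 : 0 < e / 2 by lra.
have [N hN] := (si_cvgP bP _ _).1 vz _ e2.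
exists N => n /hN vn; apply: le_lt_trans (siB_le bP _ z _) _.
by rewrite zy0; lra.
Qed.

(* The component of (x, 0) along G is (f, k) with k = G f and G k = x - f. *)
Lemma sa_resolvent x : exists f k, G (f, k) /\ G (k, x - f).
Proof.
have [[f k] /sa_closed Gfk orth] :=
  si_projection prod_semi_inner (x, 0) prod_complete sa_subspace.
exists f, k; split=> //; apply/Gsa => u v /orth.
rewrite /prod_ip /= sub0r (siNl bP) => /eqP; rewrite subr_eq0 => /eqP.
by rewrite (si_sym bP v) (si_sym bP u) => ->.
Qed.

(* The graph-norm component r of (x, y) orthogonal to the domain of G^2 pairs to
   zero with the range of 1 + G^2, which contains r by [sa_resolvent]. *)
Lemma sa_square_core x y : G (x, y) ->
  si_closure b [set v | exists u w, G (u, v) /\ G (v, w)] y.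
Proof.
move=> Gxy; pose W := [set p | G p /\ exists w, G (p.2, w)].
have GL := sa_subspace.2.
have WL : subspace W.
  split; first by split; [exact: sa_subspace.1|exists 0; exact: sa_subspace.1].
  move=> a [p q] [p' q'] [Gp [w Gw]] [Gp' [w' Gw']]; split; first exact: GL.
  by exists (a *: w + w'); exact: (GL a _ _ Gw Gw').
have [[m1 m2] Wm orth] := si_projection prod_semi_inner (x, y) prod_complete WL.
have WG : W `<=` si_closure prod_ip G.
  by move=> p [Gp _]; exact: (sub_si_closure prod_semi_inner).
have Gm : G (m1, m2) by apply/sa_closed/(si_closure_min prod_semi_inner WG).
have Gr : G (x - m1, y - m2).
  exact: sa_sub.
have r0 : b (x - m1) (x - m1) = 0.
  have [f [k [Gfk Gkr]]] := sa_resolvent (x - m1).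
  (* Write [r] for [(x - m1, y - m2)]. Symmetry turns the pairing of [r.2] with [k] into that of
     [r.1] with [r.1 - f]; adding the pairing of [r.1] with [f] leaves the squared norm of [r.1]. *)
  have := orth (f, k); rewrite /prod_ip /= => <-.
    rewrite (si_sym bP (y - m2)) -(sa_sym Gr Gkr) -(si_sym bP (x - m1)).
    rewrite -(siDr bP).
    by rewrite [f + _]addrC subrK.
  by split=> //; exists (x - m1 - f).
have r20 : b (y - m2) (y - m2) = 0.
  apply: (si_closure_orth bP) (Gdense _) => u [v Guv].
  by rewrite (si_sym bP) -(sa_sym Gr Guv) si_orth.
move=> e e0; have e4 : 0 < e / 4 by lra.
have [[u v] [/= Guv [w Gvw]]] := Wm _ e4.
rewrite /prod_ip /= => uv; exists v; first by exists u, w.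
apply: le_lt_trans (siB_le bP _ m2 _) _; rewrite r20.
by have := si_ge0 bP (m1 - u); lra.
Qed.

End SelfAdjointRelation.

(** * Completeness of L2 *)

Section L2Space.
Context d (X : measurableType d) (R : realType).
Variable nu : {measure set X -> \bar R}.
Local Notation L2 := (L2 nu).
Implicit Types f g h : L2.

Lemma L2_addE f g x : (f + g) x = f x + g x. Proof. by []. Qed.
Lemma L2_oppE f x : (- f) x = - f x. Proof. by []. Qed.
Lemma L2_scaleE a f x : (a *: f) x = a * f x. Proof. by []. Qed.

Lemma L2_sumE (I : Type) (s : seq I) (F : I -> L2) x :
  (\sum_(i <- s) F i) x = \sum_(i <- s) F i x.
Proof.
by elim: s => [|i s IH]; rewrite ?big_nil// !big_cons L2_addE IH.
Qed.

Lemma L2_measurable f : measurable_fun setT f.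
Proof. exact: measurable_funPT. Qed.

Lemma ip_integrable f g : nu.-integrable setT (EFin \o (fun x => f x * g x)).
Proof. by apply/Lfun1_integrable/Lfun2_mul_Lfun1; exact: LfunP. Qed.

Lemma ip_integral f g : (\int[nu]_x (f x * g x)%:E)%E = (ip f g)%:E.
Proof.
rewrite /ip /Rintegral fineK//.
exact: integrable_fin_num (ip_integrable f g).
Qed.

Lemma ip_semi_inner : semi_inner (@ip _ _ _ nu).
Proof.
split=> [a f g h|f g|f].
- rewrite /ip -RintegralZl//; last exact: ip_integrable.
  rewrite -RintegralD//; last 2 first.
  + exact: (integrableZl measurableT a (ip_integrable f h)).
  + exact: ip_integrable.
  by apply: eq_Rintegral => x _; rewrite L2_addE L2_scaleE; ring.
- by apply: eq_Rintegral => x _; rewrite mulrC.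
- by apply: Rintegral_ge0 => x _; rewrite -expr2 sqr_ge0.
Qed.

Lemma sqn_eq0 f : sqn f = 0 <-> f = 0 %[ae nu].
Proof.
have mff := measurable_int _ (ip_integrable f f).
have := ae_eq_integral_abs nu measurableT mff.
rewrite [X in X = 0%E <-> _](_ : _ = (sqn f)%:E); last first.
  rewrite -ip_integral; apply: eq_integral => x _ /=.
  by rewrite -expr2 ger0_norm// sqr_ge0.
move=> H; split=> [f0|f0].
  have /H : (sqn f)%:E = 0%E by rewrite f0.
  apply: filterS => x /= /[apply] -[] /eqP.
  by rewrite mulf_eq0 orbb => /eqP.
have /H[] // : ae_eq nu setT (EFin \o (fun x => f x * f x)) (cst 0%E).
by apply: filterS f0 => x /= /[apply] ->; rewrite mulr0.
Qed.

Lemma ae_eqP f g : f = g %[ae nu] <-> sqn (f - g) = 0.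
Proof.
rewrite sqn_eq0; split; apply: filterS => x fg xT.
  by rewrite L2_addE L2_oppE fg// subrr.
by apply/eqP; rewrite -subr_eq0; apply/eqP; exact: fg.
Qed.

Lemma ip_ae f g h : f = g %[ae nu] -> ip f h = ip g h.
Proof.
move=> /ae_eqP/(si_orth ip_semi_inner h).
rewrite (si_sym ip_semi_inner) (siDl ip_semi_inner) (siNl ip_semi_inner).
by move/eqP; rewrite subr_eq0 => /eqP.
Qed.

Lemma sqn_ae f g : f = g %[ae nu] -> sqn f = sqn g.
Proof.
move=> fg; rewrite /sqn (ip_ae _ fg) (si_sym ip_semi_inner) (ip_ae _ fg).
by [].
Qed.

Lemma L2_of_sqr (f : X -> R) : measurable_fun setT f ->
  (\int[nu]_x (f x ^+ 2)%:E < +oo)%E -> f \in Lfun nu 2%:R%:E.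
Proof.
move=> mf foo; apply/andP; split; rewrite inE /=; first exact: mf.
rewrite /finite_norm unlock /=; apply: poweR_lty.
apply: le_lt_trans foo; rewrite le_eqVlt; apply/orP; left; apply/eqP.
apply: eq_integral => x _.
by rewrite powR_mulrn// real_normK// num_real.
Qed.

End L2Space.

(** * Limits almost everywhere and monotone convergence *)

Section AlmostEverywhereLimits.
Context d (X : measurableType d) (R : realType).
Variable nu : {measure set X -> \bar R}.
Local Notation L2 := (L2 nu).

(* Where w diverges, this is still measurable, with no particular value. *)
Definition lim_fun (w : nat -> X -> R) : X -> R :=
  fun x => fine (limn_esup (fun k => (w k x)%:E)).

Lemma measurable_lim_fun (w : nat -> X -> R) :
  (forall k, measurable_fun setT (w k)) -> measurable_fun setT (lim_fun w).
Proof.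
move=> mw; apply: (measurableT_comp (fine_measurable _)) => //.
apply: measurable_fun_limn_esup => k.
exact/measurable_EFinP.
Qed.

Lemma lim_funE (w : nat -> X -> R) x l :
  (fun k => w k x) @ \oo --> l -> lim_fun w x = l.
Proof.
move=> wl; rewrite /lim_fun.
have wlE : (fun k => (w k x)%:E) @ \oo --> l%:E by move/cvg_comp : wl; apply.
by rewrite (cvg_limn_einf_sup wlE).2.
Qed.

(** Every function is replaced by zero on a measurable null set [N] outside which the hypotheses
    hold; the everywhere version then applies. *)
Lemma ae_monotone_convergence (D : set X) (g : nat -> X -> \bar R)
    (f : X -> \bar R) :
  measurable D -> (forall n, measurable_fun setT (g n)) ->
  measurable_fun setT f ->
  {ae nu, forall x, forall n, (0 <= g n x)%E /\ (g n x <= g n.+1 x)%E} ->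
  {ae nu, forall x, (fun n => g n x) @ \oo --> f x} ->
  (fun n => (\int[nu]_(x in D) g n x)%E) @ \oo --> (\int[nu]_(x in D) f x)%E.
Proof.
move=> mD mg mf gm gf.
have [N [mN N0 PN]] := filterI gm gf.
have NP x : ~ N x -> (forall n, (0 <= g n x)%E /\ (g n x <= g n.+1 x)%E) /\
    (fun n => g n x) @ \oo --> f x.
  by move=> Nx; apply: contrapT => H; apply: Nx; exact: PN.
have restrE (h : X -> \bar R) : measurable_fun setT h ->
    (\int[nu]_(x in D) h x = \int[nu]_(x in D) (h \_ (~` N)) x)%E.
  move=> mh; apply: ae_eq_integral => //.
  - exact: measurable_funTS.
  - apply: measurable_funTS; apply/(measurable_restrictT _ _).1.
      exact: measurableC.
    exact: measurable_funTS.
  - exists N; split=> // x /= /not_implyP[_] hx; apply: contrapT => Nx.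
    by apply: hx; rewrite patchE mem_set.
rewrite restrE//; under eq_fun do rewrite restrE//.
have patchN (h : X -> \bar R) x : N x -> (h \_ (~` N)) x = 0%E.
  by move=> Nx; rewrite patchE memNset//; exact.
have patchC (h : X -> \bar R) x : ~ N x -> (h \_ (~` N)) x = h x.
  by move=> Nx; rewrite patchE mem_set.
rewrite (eq_integral (fun x => limn (fun n => (g n \_ (~` N)) x))); last first.
  move=> x _; apply/esym/cvg_lim => //.
  have [Nx|Nx] := pselect (N x).
    by under eq_fun do rewrite patchN//; rewrite patchN//; exact: cvg_cst.
  by under eq_fun do rewrite patchC//; rewrite patchC//; exact: (NP _ Nx).2.
apply: cvg_monotone_convergence => //.
- move=> n; apply: measurable_funTS; apply/(measurable_restrictT _ _).1.
    exact: measurableC.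
  exact: measurable_funTS.
- move=> n x _; have [Nx|Nx] := pselect (N x); first by rewrite patchN.
  by rewrite patchC//; exact: ((NP _ Nx).1 n).1.
- move=> x _; apply/nondecreasing_seqP => n.
  have [Nx|Nx] := pselect (N x); first by rewrite !patchN.
  by rewrite !patchC//; exact: ((NP _ Nx).1 n).2.
Qed.

(** Taking roots bounds the increments by [Num.sqrt C] times [2^-1 ^+ k], so the telescoping series
    converges absolutely. *)
Lemma geometric_increments_cvg (w : nat -> R) (C : R) :
  (forall k, 4 ^+ k * (w k.+1 - w k) ^+ 2 <= C) -> cvgn w.
Proof.
move=> wC; have C0 : 0 <= C.
  by apply: le_trans (wC 0%N); rewrite mulr_ge0 ?sqr_ge0.
have incr k : `|w k.+1 - w k| <= geometric (Num.sqrt C) 2^-1 k.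
  rewrite /= exprVn ler_pdivlMr ?exprn_gt0//.
  rewrite -(@ger0_norm _ (2 ^+ k)) ?exprn_ge0//.
  rewrite -normrM -sqrtr_sqr ler_wsqrtr// exprMn -exprM mulnC exprM mulrC.
  by rewrite (_ : 2 ^+ 2 = 4 :> R)//; ring.
have : cvgn (series (telescope w)).
  apply: normed_cvg; apply: series_le_cvg incr _.
  - by move=> n /=.
  - by move=> n; apply: geometric_ge0; rewrite ?sqrtr_ge0.
  - by apply: is_cvg_geometric_series; rewrite ger0_norm//; lra.
rewrite telescopeK => cv.
rewrite (_ : w = (fun n => w n - w 0%N + w 0%N)).
  by apply: is_cvgD => //; exact: is_cvg_cst.
by apply/funext => n; rewrite subrK.
Qed.

End AlmostEverywhereLimits.

(** * The Riesz-Fischer theorem *)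

Section RieszFischer.
Context d (X : measurableType d) (R : realType).
Variable nu : {measure set X -> \bar R}.
Local Notation L2 := (L2 nu).
Let ipP := ip_semi_inner nu.

Lemma integral_sqr (f : L2) : (\int[nu]_x (f x ^+ 2)%:E)%E = (sqn f)%:E.
Proof. by rewrite -ip_integral. Qed.

(* The sum of 4^k |w (k+1) - w k|^2 has finite integral, so almost everywhere
   the increments are O(2^-k). *)
Lemma ae_cvg_fast_cauchy (w : nat -> L2) :
  (forall k, sqn (w k.+1 - w k) <= 8^-1 ^+ k) ->
  {ae nu, forall x, cvgn (fun k => w k x)}.
Proof.
move=> wk.
pose G k x : \bar R := ((4 ^+ k * (w k.+1 x - w k x) ^+ 2)%:E).
have mG k : measurable_fun setT (G k).
  apply/measurable_EFinP; apply: measurable_funM => //.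
  by apply: measurable_funX; apply: measurable_funB; exact: L2_measurable.
have G0 k x : (0 <= G k x)%E by rewrite lee_fin mulr_ge0 ?sqr_ge0.
have mS : measurable_fun setT (fun x => \sum_(k <oo) G k x)%E.
  exact: ge0_emeasurable_sum.
have intG k : (\int[nu]_x G k x <= (geometric 1 2^-1 k)%:E)%E.
  rewrite /G; under eq_integral do rewrite EFinM.
  rewrite ge0_integralZl//; last 2 first.
  - apply/measurable_EFinP; apply: measurable_funX.
    by apply: measurable_funB; exact: L2_measurable.
  - by move=> x _; rewrite lee_fin sqr_ge0.
  rewrite (integral_sqr (w k.+1 - w k)) -EFinM lee_fin.
  apply: le_trans (ler_wpM2l _ (wk k)) _; first exact: exprn_ge0.
  by rewrite -exprMn /= mul1r (_ : 4 * 8^-1 = 2^-1 :> R)//; lra.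
have Soo : (\int[nu]_x (\sum_(k <oo) G k x) < +oo)%E.
  rewrite integral_nneseries//.
  apply: (@le_lt_trans _ _ (\sum_(k <oo) (geometric 1 2^-1 k)%:E)%E).
    by apply: lee_nneseries => // k _ _; exact: integral_ge0.
  have h : series (geometric 1 2^-1) @ \oo --> (1 * (1 - 2^-1)^-1 : R).
    by apply: cvg_geometric_series; rewrite ger0_norm//; lra.
  rewrite (_ : limn _ = (1 * (1 - 2^-1)^-1)%:E) ?ltry//.
  apply/cvg_lim => //; under eq_fun do rewrite sumEFin.
  by move/cvg_comp : h; apply.
have /(integrable_ae measurableT) :
    nu.-integrable setT (fun x => \sum_(k <oo) G k x)%E.
  apply/integrableP; split=> //.
  by under eq_integral do rewrite gee0_abs ?nneseries_ge0//.
apply: filterS => x /(_ Logic.I) Sx.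
apply: (@geometric_increments_cvg _ _ (fine (\sum_(k <oo) G k x)%E)) => k.
rewrite -lee_fin fineK//.
apply: le_trans (nneseries_lim_ge k.+1 _) => //.
by rewrite big_nat_recr//= leeDr// sume_ge0.
Qed.

(** Fatou's lemma in [m], applied to the squares of [w m - w k], transfers the bound [e k] to the
    limit function. *)
Lemma L2_limit_of_ae_cvg (w : nat -> L2) (f : X -> R) (e : nat -> R) :
  measurable_fun setT f ->
  {ae nu, forall x, (fun k => w k x) @ \oo --> f x} ->
  (forall k m, (k <= m)%N -> sqn (w m - w k) <= e k) ->
  exists g : L2, g = f :> (X -> R) /\ forall k, sqn (g - w k) <= e k.
Proof.
move=> mf wf we.
have fatou_wk k : (\int[nu]_x ((f x - w k x) ^+ 2)%:E <= (e k)%:E)%E.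
  rewrite (ae_eq_integral (fun x => limn_einf (fun m =>
      ((w m x - w k x) ^+ 2)%:E)))//; last 3 first.
  - exact/measurable_EFinP/measurable_funX/measurable_funB.
  - rewrite /limn_einf; apply: measurableT_comp => //.
    apply: measurable_fun_limn_esup => m; apply: measurableT_comp => //.
    exact/measurable_EFinP/measurable_funX/measurable_funB.
  - apply: filterS wf => x wx _; apply/esym.
    have h : (fun m => ((w m x - w k x) ^+ 2)%:E) @ \oo -->
        ((f x - w k x) ^+ 2)%:E.
      have : (fun m => (w m x - w k x) ^+ 2) @ \oo --> (f x - w k x) ^+ 2.
        have wkx : (fun m => w m x - w k x) @ \oo --> f x - w k x.
          by apply: cvgB => //; exact: cvg_cst.
        by under eq_fun do rewrite expr2; rewrite expr2; exact: cvgM.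
      by move/cvg_comp; apply.
    by rewrite (cvg_limn_einf_sup h).1.
  apply: le_trans (fatou _ _ _ _) _ => //.
  - move=> m; apply/measurable_EFinP/measurable_funX/measurable_funB;
    exact: L2_measurable.
  - by move=> m x _; rewrite lee_fin sqr_ge0.
  - rewrite limn_einf_lim.
    apply: lime_le; first exact: is_cvg_einfs.
    (* The infimum over the tail from [m] is compared with its member at [maxn m k], since the bound
       holds only for indices at least [k]. *)
    apply: nearW => m; apply: (@le_trans _ _ (sqn (w (maxn m k) - w k))%:E).
      rewrite -integral_sqr; apply: ereal_inf_lbound.
      by exists (maxn m k) => //=; rewrite leq_maxl.
    by rewrite lee_fin we// leq_maxr.
have mfw k : (fun x => f x - w k x) \in Lfun nu 2%:R%:E.
  apply: L2_of_sqr; last exact: le_lt_trans (fatou_wk k) (ltry _).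
  by apply/measurable_funB => //; exact: L2_measurable.
pose h k : L2 := Lfun_Sub (lee1n 2) (mfw k).
(* Fatou shows that the differences [f - w k] are square integrable, so [f] is recovered from one of
   them. *)
exists (h 0%N + w 0%N); split.
  by apply/funext => x; rewrite L2_addE /= subrK.
move=> k; rewrite -lee_fin -integral_sqr.
apply: le_trans (fatou_wk k); rewrite le_eqVlt; apply/orP; left; apply/eqP.
by apply: eq_integral => x _; rewrite !L2_addE L2_oppE /= subrK.
Qed.

Lemma L2_si_complete : si_complete (@ip _ _ _ nu).
Proof.
move=> u uc.
(* The rate [8^-1 ^+ k] leaves a summable [2^-1 ^+ k] after weighting by [4 ^+ k]. *)
have /choice[N hN] k : exists N, forall m n, (N <= m)%N -> (N <= n)%N ->
    sqn (u m - u n) < 8^-1 ^+ k by apply: uc; rewrite exprn_gt0.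
(* Partial sums make the indices monotone while dominating each [N k]. *)
pose phi k := (\sum_(i < k.+1) N i)%N.
have phi_nd : {homo phi : m n / (m <= n)%N}.
  apply: homo_leq => // [m n p|k]; first exact: leq_trans.
  by rewrite /phi [in leqRHS]big_ord_recr leq_addr.
have phiN k : (N k <= phi k)%N by rewrite /phi big_ord_recr leq_addl.
have uphi k m : (phi k <= m)%N -> sqn (u m - u (phi k)) <= 8^-1 ^+ k.
  by move=> km; apply/ltW/hN => //; exact: leq_trans km.
pose w k := u (phi k).
have wk k m : (k <= m)%N -> sqn (w m - w k) <= 8^-1 ^+ k.
  by move=> km; apply/uphi/phi_nd.
have wcv := ae_cvg_fast_cauchy (fun k => wk k k.+1 (leqnSn k)).
have [||f [_ fw]] :=
    @L2_limit_of_ae_cvg w (lim_fun w) (fun k => 8^-1 ^+ k) _ _ wk.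
- by apply: measurable_lim_fun => k; exact: L2_measurable.
- by apply: filterS wcv => x wx; rewrite (lim_funE wx).
exists f; apply/(si_cvgP ipP) => e e0; have e4 : 0 < e / 4 by lra.
have geo0 n : 0 <= geometric 1 8^-1 n :> R by rewrite geometric_ge0.
have geo : geometric 1 8^-1 @ \oo --> (0 : R).
  by apply: cvg_geometric; rewrite ger0_norm//; lra.
have [k /(_ _ (leqnn k))] := (cvg0P geo0).1 geo _ e4.
rewrite /= mul1r => ke.
exists (phi k) => n kn; apply: le_lt_trans (siB_le ipP _ (w k) _) _.
have := uphi _ _ kn; have := fw k.
by rewrite /sqn (siBC ipP f) -/(w k); lra.
Qed.

End RieszFischer.

(** * Pointwise action and densities *)

Section SimpleFunctions.
Context d (X : measurableType d) (R : realType).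
Variable nu : {measure set X -> \bar R}.
Local Notation L2 := (L2 nu).
Local Notation Fspan := (@Fspan _ _ _ nu).
Let ipP := ip_semi_inner nu.

Lemma chi_integral (A : Dfin nu) (f : L2) :
  nu.-integrable (\val A) (EFin \o f) /\
  (\int[nu]_(x in \val A) (f x)%:E)%E = (ip (chi A) f)%:E.
Proof.
have [mA _] : Dfin nu (\val A) by exact: set_valP.
have patchE : (EFin \o f) \_ (\val A) = EFin \o (fun x => chi A x * f x).
  apply/funext => x; rewrite patchE /= indicE.
  by case: ifP => _; rewrite ?mul1r ?mul0r.
split.
  by apply/(integrable_mkcond _ mA); rewrite patchE; exact: ip_integrable.
by rewrite integral_mkcond patchE -ip_integral.
Qed.

Lemma has_density_chi (f : L2) : has_density (fun A => ip (chi A) f) f.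
Proof.
by move=> A; have [fA intf] := chi_integral A f; rewrite /Rintegral intf.
Qed.

Lemma Fspan_chi (A : Dfin nu) : Fspan (chi A).
Proof. by exists [:: (1, A)]; rewrite big_seq1 scale1r. Qed.

(** Chebyshev's inequality: [y ^+ 2] times the measure of [A] is at most [sqn f]. *)
Lemma level_set_Dfin (f : L2) (A : set X) (y : R) : measurable A -> 0 < y ->
  (forall x, A x -> y <= f x) -> Dfin nu A.
Proof.
move=> mA y0 Af; split=> //; rewrite -[A]setIT -integral_indic//.
have : ((y ^+ 2)%:E * \int[nu]_x (\1_A x)%:E <= (sqn f)%:E)%E.
  rewrite -integral_sqr -ge0_integralZl//; last 2 first.
  - exact/measurable_EFinP/measurable_indicP.
  - by rewrite lee_fin sqr_ge0.
  apply: ge0_le_integral => //.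
  - by move=> x _; rewrite mule_ge0// lee_fin sqr_ge0.
  - by apply: measurable_funeM; exact/measurable_EFinP/measurable_indicP.
  - exact/measurable_EFinP/measurable_funX.
  move=> x _; rewrite -EFinM lee_fin indicE.
  case: (boolP (x \in A)) => [/set_mem /Af yf|_]; last by rewrite mulr0 sqr_ge0.
  rewrite mulr1.
  by rewrite ler_pXn2r// ?nnegrE ltW// (lt_le_trans y0).
case: (\int[nu]_x _)%E => [r _|/=|]; [exact: ltry| |by rewrite ltNye].
by rewrite gt0_muley ?lte_fin ?exprn_gt0.
Qed.

Import HBNNSimple.

Lemma nnsfun_Fspan (h : {nnsfun X >-> R}) (f : L2) :
  (forall x, h x <= f x) -> exists2 g : L2, Fspan g & g = h :> (X -> R).
Proof.
move=> hf; pose A y := h @^-1` [set y].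
have AD y : y \in range h -> y != 0 -> Dfin nu (A y).
  move=> /set_mem[x _ <-] hx0; apply: (@level_set_Dfin f _ (h x)).
  - exact: measurable_funPTI.
  - by rewrite lt_neqAle eq_sym hx0 fun_ge0.
  - by move=> z <-; exact: hf.
have D0 : Dfin nu set0 by split; rewrite ?measure0.
(* The default [set0] can occur only at level 0, whose level set may have infinite measure and whose
   coefficient vanishes. *)
pose B y : Dfin nu := if pselect (Dfin nu (A y)) is left H
  then exist _ (A y) (mem_set H) else exist _ set0 (mem_set D0).
have hfin : finite_set (range h) by exact: fimfunP.
pose c := [seq (y, B y) | y <- finmap.enum_fset (fset_set (range h))].
exists (\sum_(p <- c) p.1 *: chi p.2); first by exists c.
apply/funext => x; rewrite fimfunE fsbig_finite// big_map L2_sumE.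
apply: eq_big_seq => y; rewrite in_fset_set// => hy; rewrite L2_scaleE.
have [->|y0] := eqVneq y 0; first by rewrite !mul0r.
by rewrite /B; case: pselect => // /(_ (AD _ hy y0)).
Qed.

Lemma Fspan_approximation (f : L2) : (forall x, 0 <= f x) ->
  exists s : nat -> L2, [/\ forall n, Fspan (s n),
    forall x n, 0 <= s n x <= s n.+1 x &
    forall x, (fun n => s n x) @ \oo --> f x].
Proof.
move=> f0; have mf : measurable_fun setT (EFin \o f) by exact/measurable_EFinP.
have f0E x : setT x -> (0 <= (EFin \o f) x)%E by rewrite lee_fin.
pose h := nnsfun_approx measurableT mf.
have hf n x : h n x <= f x.
  by rewrite -lee_fin /h nnsfun_approxE; exact: le_approx.
have /choice[s sP] n : exists g : L2, Fspan g /\ g = h n :> (X -> R).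
  by have [g] := nnsfun_Fspan (hf n); exists g.
exists s; split=> [n|x n|x]; first exact: (sP n).1.
  rewrite (sP n).2 (sP n.+1).2 fun_ge0/=.
  by have /lefP := nd_nnsfun_approx measurableT mf (leqnSn n); exact.
rewrite (_ : (fun n => s n x) = fun n => h n x); last first.
  by apply/funext => n; rewrite (sP n).2.
have /fine_cvgP[_] := cvg_nnsfun_approx measurableT mf f0E (x := x) Logic.I.
exact.
Qed.

Lemma funrpos_Lfun2 (f : L2) : f^\+ \in Lfun nu 2%:R%:E.
Proof.
apply: L2_of_sqr; first exact: measurable_funrpos.
apply: le_lt_trans (ltry (sqn f)); rewrite -integral_sqr.
apply: ge0_le_integral => //.
- by move=> x _; rewrite lee_fin sqr_ge0.
- exact/measurable_EFinP/measurable_funX/measurable_funrpos.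
- exact/measurable_EFinP/measurable_funX.
move=> x _; rewrite lee_fin /funrpos; case: (leP (f x) 0) => // _.
by rewrite expr0n sqr_ge0.
Qed.

Definition L2_pos (f : L2) : L2 := Lfun_Sub (lee1n 2) (funrpos_Lfun2 f).

Lemma L2_posE (f : L2) : L2_pos f = f^\+ :> (X -> R). Proof. by []. Qed.

Lemma L2_negE (f : L2) : L2_pos (- f) = f^\- :> (X -> R).
Proof. by []. Qed.

Lemma L2_posneg (f : L2) : L2_pos f - L2_pos (- f) = f.
Proof.
apply/LfuneqP => x; rewrite L2_addE L2_oppE L2_posE L2_negE /funrpos /funrneg.
by case: (leP (f x) 0) => fx; case: (leP (- f x) 0) => fx'; lra.
Qed.

Lemma ip_monotone_cvg (k f : L2) (s : nat -> L2) :
  {ae nu, forall x, 0 <= k x} ->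
  {ae nu, forall x, forall n, 0 <= s n x <= s n.+1 x} ->
  {ae nu, forall x, (fun n => s n x) @ \oo --> f x} ->
  (fun n => (ip k (s n))%:E) @ \oo --> (ip k f)%:E.
Proof.
move=> k0 sm sf; under eq_fun do rewrite -ip_integral; rewrite -ip_integral.
apply: ae_monotone_convergence => //.
- by move=> n; exact/measurable_EFinP/measurable_funM.
- exact/measurable_EFinP/measurable_funM.
- apply: filterS2 k0 sm => x k0 sm n; have /andP[s0 s1] := sm n.
  by rewrite !lee_fin mulr_ge0// ler_wpM2l.
- apply: filterS sf => x sf.
  have : (fun n => k x * s n x) @ \oo --> k x * f x by exact: cvgMr.
  by move/cvg_comp; apply.
Qed.

End SimpleFunctions.

(** * Monotone limits of the operator along simple functions *)

Section PointwiseAction.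
Context d (X : measurableType d) (R : realType).
Variable nu : {sigma_finite_measure set X -> \bar R}.
Local Notation L2 := (L2 nu).
Local Notation Fspan := (@Fspan _ _ _ nu).
Let ipP := ip_semi_inner nu.
Variable T : operator nu.
Hypothesis hT : admissible T.

Let Fdom := adm_span hT.

Lemma chi_ge0 (A : Dfin nu) x : 0 <= chi A x.
Proof. by rewrite /= indicE. Qed.

Lemma app_chi_ge0 (A : Dfin nu) : {ae nu, forall x, 0 <= T (chi A) x}.
Proof.
apply: (adm_pos hT); first exact/Fdom/Fspan_chi.
by apply: aeW => x; exact: chi_ge0.
Qed.

Lemma ip_chi_app (A : Dfin nu) (f : L2) : dom T f ->
  ip (chi A) (T f) = ip (T (chi A)) f.
Proof. by move=> Tf; apply/esym/(adm_sym hT) => //; exact/Fdom/Fspan_chi. Qed.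

Lemma app_sub (f g : L2) : dom T f -> dom T g ->
  dom T (f - g) /\ T (f - g) = T f - T g %[ae nu].
Proof.
move=> Tf Tg; rewrite [f - g]addrC -scaleN1r; split; first exact: dom_lin.
by rewrite [T f - _]addrC -[- T g]scaleN1r; exact: app_lin.
Qed.

(** Positivity is applied to [s n] and to the increment [s n.+1 - s n]; countably many exceptional
    null sets are merged by [ae_foralln]. *)
Lemma app_ae_monotone (s : nat -> L2) : (forall n, Fspan (s n)) ->
  {ae nu, forall x, forall n, 0 <= s n x <= s n.+1 x} ->
  {ae nu, forall x, forall n, 0 <= T (s n) x <= T (s n.+1) x}.
Proof.
move=> sF sm; apply: ae_foralln => n.
have Ts m : dom T (s m) by exact: Fdom.
have s0 : {ae nu, forall x, 0 <= T (s n) x}.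
  by apply: (adm_pos hT) => //; apply: filterS sm => x /(_ n)/andP[].
have [TB appB] := app_sub (Ts n.+1) (Ts n).
have sB0 : {ae nu, forall x, 0 <= T (s n.+1 - s n) x}.
  apply: (adm_pos hT) => //; apply: filterS sm => x /(_ n)/andP[_ ss].
  by rewrite L2_addE L2_oppE subr_ge0.
apply: filterS2 s0 (filterI sB0 appB) => x sx [sBx /(_ Logic.I) eqx].
by rewrite sx -subr_ge0; move: sBx; rewrite eqx.
Qed.

(** Symmetry moves [T] onto [chi A], so the limit is finite even when [f] is outside the domain of
    [T]. *)
Lemma app_simple_integral_cvg (f : L2) (s : nat -> L2) (A : Dfin nu) :
  (forall n, Fspan (s n)) ->
  {ae nu, forall x, forall n, 0 <= s n x <= s n.+1 x} ->
  {ae nu, forall x, (fun n => s n x) @ \oo --> f x} ->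
  (fun n => (\int[nu]_(x in \val A) (T (s n) x)%:E)%E) @ \oo -->
  (ip (T (chi A)) f)%:E.
Proof.
move=> sF sm sf.
rewrite (_ : (fun n => _) = fun n => (ip (T (chi A)) (s n))%:E); last first.
  apply/funext => n; rewrite (chi_integral A _).2 ip_chi_app//.
  exact: Fdom.
by apply: ip_monotone_cvg => //; exact: app_chi_ge0.
Qed.

Lemma monotone_limit_density (f : L2) (hp : X -> R) : monotone_limit T f hp ->
  exists h, [/\ measurable_fun setT h, h = hp %[ae nu] &
    forall A : Dfin nu, nu.-integrable (\val A) (EFin \o h) /\
      (\int[nu]_(x in \val A) (h x)%:E)%E = (ip (T (chi A)) f)%:E].
Proof.
(* [hp] is known only almost everywhere and need not be measurable; [lim_fun] supplies a measurable
   version. *)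
move=> [s [sF sm sf shp]]; exists (lim_fun (fun n => T (s n))).
set h := lim_fun _.
have hhp : {ae nu, forall x, h x = hp x}.
  by apply: filterS shp => x cv; exact: (lim_funE (w := fun n => T (s n))).
have mh : measurable_fun setT h.
  by apply: measurable_lim_fun => n; exact: L2_measurable.
split=> // [|A]; first by apply: filterS hhp.
have [mA _] : Dfin nu (\val A) by exact: set_valP.
have Tm := app_ae_monotone sF sm.
have h0 : {ae nu, forall x, 0 <= h x}.
  apply: filterS2 shp (filterI hhp Tm) => x cv [-> Tx].
  rewrite -(cvg_lim (@Rhausdorff R) cv); apply: limr_ge; first exact: cvgP cv.
  by apply: nearW => n; case/andP: (Tx n).
have inth : (\int[nu]_(x in \val A) (h x)%:E)%E = (ip (T (chi A)) f)%:E.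
  have := app_simple_integral_cvg (A := A) sF sm sf.
  apply: cvg_unique => //; apply: ae_monotone_convergence => //.
  - by move=> n; exact/measurable_EFinP.
  - exact/measurable_EFinP.
  - by apply: filterS Tm => x Tx n; rewrite !lee_fin; exact/andP.
  - apply: filterS2 hhp shp => x -> cv.
    by move/cvg_comp : cv; apply.
split=> //; apply/integrableP; split.
  exact/measurable_EFinP/measurable_funTS.
rewrite (ae_eq_integral (EFin \o h))//; first by rewrite inth ltry.
- exact/measurableT_comp/measurable_EFinP/measurable_funTS.
- exact/measurable_EFinP/measurable_funTS.
- by apply: filterS h0 => x hx _ /=; rewrite ger0_norm.
Qed.

Lemma monotone_limit_exists (f : L2) : (forall x, 0 <= f x) ->
  exists2 h, measurable_fun setT h & monotone_limit T f h.
Proof.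
move=> f0; have [s [sF sm sf]] := Fspan_approximation f0.
have sm' : {ae nu, forall x, forall n, 0 <= s n x <= s n.+1 x} by exact: aeW.
have sf' : {ae nu, forall x, (fun n => s n x) @ \oo --> f x} by exact: aeW.
have Tm := app_ae_monotone sF sm'.
(* Monotonicity gives a limit in the extended reals first; its finiteness is a separate matter,
   settled by integration. *)
pose G x := limn_esup (fun n => (T (s n) x)%:E).
have mG : measurable_fun setT G.
  by apply: measurable_fun_limn_esup => n; exact/measurable_EFinP.
have TG : {ae nu, forall x, (fun n => (T (s n) x)%:E) @ \oo --> G x}.
  apply: filterS Tm => x Tx.
  have cv : cvgn (fun n => (T (s n) x)%:E).
    apply: ereal_nondecreasing_is_cvgn; apply/nondecreasing_seqP => n.
    by rewrite lee_fin; case/andP: (Tx n).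
  by rewrite /G is_cvg_limn_esupE.
have G0 : {ae nu, forall x, (0 <= G x)%E}.
  apply: filterS2 TG Tm => x cv Tx.
  rewrite -(cvg_lim _ cv)//; apply: lime_ge; first exact: cvgP cv.
  by apply: nearW => n; rewrite lee_fin; case/andP: (Tx n).
(* On a set A of finite measure the limit has finite integral <T chi_A, f>. *)
have GA (A : set X) : Dfin nu A -> {ae nu, forall x, A x -> G x \is a fin_num}.
  move=> DA; have [mA _] := DA.
  apply: (@integrable_ae _ _ _ nu A mA G); apply/integrableP; split.
    exact: measurable_funTS.
  rewrite (ae_eq_integral G)//.
  - pose A' : Dfin nu := exist _ A (mem_set DA).
    rewrite (_ : integral _ _ _ = (ip (T (chi A')) f)%:E) ?ltry//.
    have := app_simple_integral_cvg (A := A') sF sm' sf'.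
    apply: cvg_unique => //; apply: ae_monotone_convergence => //.
      by move=> n; exact/measurable_EFinP.
    by apply: filterS Tm => x Tx n; rewrite !lee_fin; exact/andP.
  - exact/measurableT_comp/measurable_funTS.
  - exact: measurable_funTS.
  - by apply: filterS G0 => x Gx _ /=; rewrite gee0_abs.
have Gfin : {ae nu, forall x, G x \is a fin_num}.
  have [F FT FD] := sigma_finiteT nu.
  have : {ae nu, forall x, forall i, F i x -> G x \is a fin_num}.
    by apply: ae_foralln => i; exact/GA/FD.
  apply: filterS => x Fx.
  have [i _ /Fx//] : (\bigcup_i F i) x by rewrite -FT.
exists (lim_fun (fun n => T (s n))).
  by apply: measurable_lim_fun => n; exact: L2_measurable.
exists s; split=> //; apply: filterS2 Gfin TG => x Gx cv.
have /fine_cvgP[_] : (fun n => (T (s n) x)%:E) @ \oo --> (fine (G x))%:E.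
  by rewrite fineK.
exact.
Qed.

Lemma pointwise_action_exists (f : L2) : exists h, pointwise_action T f h.
Proof.
have [|hp mhp hpP] := @monotone_limit_exists (L2_pos f).
  by move=> x; exact: funrpos_ge0.
have [|hm mhm hmP] := @monotone_limit_exists (L2_pos (- f)).
  by move=> x; exact: funrpos_ge0.
exists (hp \- hm); split; first exact: measurable_funB.
exists hp, hm; split=> //; exact: aeW.
Qed.

(** The positive and negative parts of [f] have densities [p] and [m], measurable versions of [hp]
    and [hm]; on a set of finite measure both are integrable and can be subtracted. *)
Lemma pointwise_action_density (f : L2) h : pointwise_action T f h ->
  has_density (hat T f) h.
Proof.
move=> [mh [hp [hm [hpP hmP hE]]]] A.
have [mA _] : Dfin nu (\val A) by exact: set_valP.
have [p [mp php /(_ A)[pi pI]]] := @monotone_limit_density (L2_pos f) _ hpP.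
have [m [mm mhm /(_ A)[mi mI]]] := @monotone_limit_density (L2_pos (- f)) _ hmP.
have hpm : ae_eq nu (\val A) (EFin \o h) (EFin \o (p \- m)).
  apply: filterS2 hE (filterI php mhm) => x hx [px mx] _.
  by rewrite /= hx// px// mx.
have pmi : nu.-integrable (\val A) (EFin \o (p \- m)).
  by rewrite (_ : _ \o _ = (EFin \o p) \- (EFin \o m))%E//; exact: integrableB.
have mhA : measurable_fun (\val A) (EFin \o h).
  exact/measurable_EFinP/measurable_funTS.
split.
  apply/integrableP; split=> //; have /integrableP[mpm] := pmi.
  rewrite (ae_eq_integral (abse \o (EFin \o (p \- m))))//.
  - exact: measurableT_comp.
  - exact: measurableT_comp.
  - exact: ae_eq_abse.
rewrite /Rintegral (ae_eq_integral (EFin \o (p \- m)))//; last first.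
  exact: measurable_int pmi.
rewrite (_ : _ \o _ = (EFin \o p) \- (EFin \o m))%E// integralB// pI mI.
rewrite -EFinB /= -(siNr ipP) -(siDr ipP) L2_posneg.
by [].
Qed.

End PointwiseAction.

(** * The square root of the Friedrichs extension *)

Section FriedrichsSquareRoot.
Context d (X : measurableType d) (R : realType).
Variable nu : {sigma_finite_measure set X -> \bar R}.
Local Notation L2 := (L2 nu).
Local Notation Fspan := (@Fspan _ _ _ nu).
Let ipP := ip_semi_inner nu.
Let L2c := @L2_si_complete _ X R nu.
Variables T That S : operator nu.
Hypotheses (hT : admissible T) (hThat : friedrichs_extension T That).
Hypothesis hS : is_sqrt S That.

Definition graph_set (U : operator nu) : set (L2 * L2) :=
  [set p | graph U p.1 p.2].
Local Notation G := (graph_set S).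

Lemma graph_app (U : operator nu) f : dom U f -> graph U f (U f).
Proof. by move=> Uf; split=> //; exact: aeW. Qed.

Lemma graph_ae (U : operator nu) (f g h : L2) :
  graph U f g -> g = h %[ae nu] -> graph U f h.
Proof. by move=> [Uf fg] gh; split=> //; exact: ae_eq_trans gh. Qed.

Lemma graph_unique (U : operator nu) (f g h : L2) :
  graph U f g -> graph U f h -> g = h %[ae nu].
Proof. by move=> [_ fg] [_ fh]; apply: ae_eq_trans fh; exact: ae_eq_sym. Qed.

Lemma ran_ae (g h : L2) : ran S g -> g = h %[ae nu] -> ran S h.
Proof. by move=> [f Sfg] gh; exists f; exact: graph_ae gh. Qed.

Lemma sqrt_graph_self_adjoint f h :
  G (f, h) <-> forall u v, G (u, v) -> ip v f = ip u h.
Proof.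
have [[_ Ssa] _ _] := hS; split=> [/Ssa Sf u v [Su uv]|Sf].
  by rewrite -(ip_ae f uv); exact: Sf.
by apply/Ssa => u Su; apply: Sf; exact: graph_app.
Qed.

Lemma sqrt_graph_dense f :
  si_closure (@ip _ _ _ nu) [set u | exists v, G (u, v)] f.
Proof.
have [[Sd _] _ _] := hS => e /(Sd f)[u Su fu]; exists u => //.
by exists (S u); exact: graph_app.
Qed.

Local Notation Gsa := sqrt_graph_self_adjoint.

(** The constant sequence puts [f] in the form domain, and symmetry puts [(f, T f)] in the adjoint
    graph. *)
Lemma friedrichs_app f : dom T f -> graph That f (T f).
Proof.
move=> Tf; apply/hThat; split; last first.
  by move=> u Tu; exact: (adm_sym hT).
exists (fun=> f); split=> //; first exact: si_cvg_cst.
move=> e e0; exists 0%N => m n _ _.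
by rewrite subrr (si0r ipP).
Qed.

Lemma sqrt_app f : dom T f -> G (f, S f) /\ G (S f, T f).
Proof.
move=> /friedrichs_app Tf; have [_ _ /(_ f (T f))[+ _]] := hS.
by move=> /(_ Tf)[Sf SSf]; split=> //; exact: graph_app.
Qed.

(** For [f] in the domain of [T], [S f] is again in the domain of [S], so one factor [S] can be
    moved across. *)
Lemma ip_sqrt f g : dom T f -> dom S g -> ip (S g) (S f) = ip (T f) g.
Proof.
move=> /sqrt_app[_ SSf] Sg.
by rewrite (sa_sym Gsa SSf (graph_app Sg)) (si_sym ipP).
Qed.

Lemma chi_dom (A : Dfin nu) : dom T (chi A).
Proof. by apply: (adm_span hT); exact: Fspan_chi. Qed.

Lemma dom_sqrt f : dom T f -> dom S f.
Proof. by move=> /sqrt_app[[]]. Qed.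

(* K is the Gram kernel of these vectors. *)
Definition sqrt_chi (A : Dfin nu) : L2 := S (chi A).
Local Notation k := sqrt_chi.
Local Notation ev := (feature_eval (@ip _ _ _ nu) k).
Local Notation M := (feature_closure (@ip _ _ _ nu) k).

Lemma hatE f : dom S f -> hat T f = ev (S f).
Proof.
move=> Sf; apply/funext => A; rewrite /feature_eval ip_sqrt//.
exact: chi_dom.
Qed.

Lemma sqrt_feature_comb (c : seq (R * Dfin nu)) :
  G (\sum_(p <- c) p.1 *: chi p.2, feature_comb k c).
Proof.
rewrite /feature_comb; elim: c => [|p c IH].
  by rewrite !big_nil; exact: (sa_subspace ipP Gsa).1.
rewrite !big_cons; apply: ((sa_subspace ipP Gsa).2 p.1 (_, _) (_, _)) => //.
exact/graph_app/dom_sqrt/chi_dom.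
Qed.

Lemma sqrt_chi_null (A : Dfin nu) :
  nu (\val A) = 0%E -> k A = (0 : L2) %[ae nu].
Proof.
move=> A0; have [mA _] : Dfin nu (\val A) by exact: set_valP.
have chi0 : chi A = (0 : L2) %[ae nu].
  exists (\val A); split=> // x /= nx; apply: contrapT => Ax; apply: nx => _.
  by rewrite indicE memNset.
have [S0 S0E] := (sa_subspace ipP Gsa).1.
have Sk := dom_sqrt (chi_dom A).
exact: ae_eq_trans (app_ae chi0 Sk) S0E.
Qed.

Lemma feature_eval_abs_continuous g : abs_continuous (ev g).
Proof.
move=> A A0; rewrite /feature_eval (si_sym ipP) (ip_ae _ (sqrt_chi_null A0)).
exact: (si0l ipP).
Qed.

(** Operators are linear only almost everywhere, so the two values of [S] at [chi C] are compared
    inside its graph. *)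
Lemma sqrt_chi_add (A B C : Dfin nu) g :
  chi C = chi A + chi B -> ev g C = ev g A + ev g B.
Proof.
move=> ABC; rewrite /feature_eval -(siDr ipP).
have h D := graph_app (dom_sqrt (chi_dom D)).
have : G (1 *: (chi A, k A) + (chi B, k B)).
  exact: ((sa_subspace ipP Gsa).2 1 (chi A, k A) (chi B, k B) (h A) (h B)).
rewrite (_ : _ + _ = (chi C, k A + k B)) => [GC|]; last first.
  by rewrite ABC; congr (_, _); rewrite /= scale1r.
rewrite (si_sym ipP) [RHS](si_sym ipP); apply: ip_ae.
exact: graph_unique (h C) GC.
Qed.

(** * Countable additivity, from the measure on the product *)

Section Lambda.
Variable lambda : {measure set (X * X) -> \bar R}.
Hypothesis hlambda : is_symmetric_measure_of T lambda.

Lemma kernel_ofE A B : kernel_of lambda A B = ip (k A) (k B).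
Proof.
have Sk := dom_sqrt (chi_dom A).
rewrite /sqrt_chi (ip_sqrt (chi_dom B) Sk) (si_sym ipP) /kernel_of.
by have [_ ->] := hlambda.
Qed.

Lemma lambda_kernel (A B : Dfin nu) :
  lambda (\val A `*` \val B) = (kernel_of lambda A B)%:E.
Proof. by rewrite /kernel_of hlambda.2. Qed.

(** By finite additivity the partial sums miss [ev g B] by the value on the tail union [C n], so it
    remains to show that this remainder tends to zero. *)
Lemma feature_eval_signed_measure g : signed_measure_on (ev g).
Proof.
move=> A B tA BE.
have [mB finB] : Dfin nu (\val B) by exact: set_valP.
have mA n : measurable (\val (A n)).
  by have [] : Dfin nu (\val (A n)) by exact: set_valP.
pose Bn n := \bigcup_(i in [set i | (n <= i)%N]) \val (A i).
have mBn n : measurable (Bn n) by apply: bigcup_measurable => i _.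
have BnB n : Bn n `<=` \val B.
  by rewrite BE => x [i _ Aix]; exists i.
have DBn n : Dfin nu (Bn n).
  by split=> //; apply: le_lt_trans finB; apply: le_measure; rewrite ?inE.
pose C n : Dfin nu := exist _ (Bn n) (mem_set (DBn n)).
have CS n : ev g (C n) = ev g (A n) + ev g (C n.+1).
  apply: sqrt_chi_add; apply/LfuneqP => x; rewrite L2_addE /= !indicE.
  have [Ax|Ax] := pselect (\val (A n) x).
    have Bx : Bn n x by exists n => /=.
    have nBx : ~ Bn n.+1 x.
      move=> [i /= ni Aix].
      by have := tA i n I I (ex_intro _ x (conj Aix Ax)); lia.
    by rewrite (mem_set Ax) (mem_set Bx) (memNset nBx) addr0.
  have BxE : Bn n x <-> Bn n.+1 x.
    split=> -[i /= ni Aix]; exists i => //=; last exact: ltnW.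
    by rewrite ltn_neqAle ni andbT; apply/eqP => nE; apply: Ax; rewrite nE.
  rewrite (memNset Ax) add0r; congr (_%:R); congr nat_of_bool.
  by apply/idP/idP => /set_mem/BxE/mem_set.
have BC : ev g B = ev g (C 0%N).
  by congr (ev g _); apply: val_inj; rewrite /= BE; apply: eq_bigcupl.
have serE n : series (fun n => ev g (A n)) n = ev g B - ev g (C n).
  elim: n => [|n IH]; first by rewrite seriesEnat /= big_geq// BC subrr.
  rewrite seriesEnat /= big_nat_recr//= -[X in X + _]/(series _ n) IH CS.
  ring.
(* By Cauchy-Schwarz the squared remainder is at most <g, g> lambda(C n * C n),
   and the squares C n * C n decrease to the empty set. *)
apply: (@cvg_sqr_le _ _ (fun n => kernel_of lambda (C n) (C n)) _ (ip g g)).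
  move=> n.
  rewrite serE kernel_ofE mulrC addrC addKr sqrrN.
  exact: si_cauchy_schwarz.
have cv : (fun n => lambda (Bn n `*` Bn n)) @ \oo --> 0%E.
  rewrite -(measure0 lambda).
  have <- : \bigcap_n (Bn n `*` Bn n) = set0.
    apply/seteqP; split=> // -[x y] H.
    (* If [x] lies in [A i], disjointness keeps it out of the tail from [i.+1]. *)
    have [/= [i _ Aix] _] := H 0%N I.
    have [/= [j /= ij Ajx] _] := H i.+1 I.
    by have := tA i j I I (ex_intro _ x (conj Aix Ajx)); lia.
  apply: nonincreasing_cvg_mu.
  - by rewrite (lambda_kernel (C 0%N) (C 0%N)) ltry.
  - by move=> n; exact: measurableX.
  - by apply: bigcap_measurable => // n _; exact: measurableX.
  - move=> m n mn; apply/subsetPset => -[x y] [/= [i /= ni Aix] [j /= nj Ajy]].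
    by split=> /=; [exists i|exists j] => //=; exact: leq_trans mn _.
have := cv; rewrite (_ : (fun n => _) =
    EFin \o fun n => kernel_of lambda (C n) (C n)); last first.
  by apply/funext => n; rewrite /= -lambda_kernel.
by move=> /fine_cvgP[_].
Qed.

End Lambda.

Lemma ran_sqrt_sub_closure : form_core Fspan T -> ran S `<=` M.
Proof.
move=> [_ Fcore] y [x Sxy].
have kM := si_closure_min ipP.
(* Three closures are taken in turn: values of [S] on the domain of its square, on [dom T], and on
   simple functions. *)
apply: (kM _ _ _ _ (sa_square_core ipP L2c Gsa sqrt_graph_dense Sxy)).
move=> v [u [w [Suv Svw]]].
have uThat : graph That u w.
  have [Su uv] := Suv; have [Sv vw] := Svw.
  have vu := ae_eq_sym uv; have [_ _ SS] := hS.
  apply/SS; split=> //; split; first exact: dom_ae vu Sv.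
  by apply: ae_eq_trans vw; apply/ae_eq_sym/app_ae.
have [[t [Tt tu tc]] _] := (hThat u w).1 uThat.
have St n : G (t n, S (t n)) by exact/graph_app/dom_sqrt/Tt.
(* S is closed, so form convergence of t n to u makes S (t n) converge to v. *)
have Scv : si_cvg (@ip _ _ _ nu) (fun n => S (t n)) v.
  apply: (sa_cvg ipP L2c Gsa sqrt_graph_dense Suv St tu) => e /tc[N hN].
  (* The form of [T] at [t m - t n] is the squared norm of its image under [S]. *)
  exists N => m n Nm Nn; have := hN _ _ Nm Nn.
  have [Tmn _] := app_sub (Tt m) (Tt n).
  rewrite -ip_sqrt//; last exact: dom_sqrt.
  rewrite -!/(sqn _).
  by rewrite (sqn_ae (app_sub (dom_sqrt (Tt m)) (dom_sqrt (Tt n))).2).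
apply: (kM _ _ _ _ (_ : si_closure _ [set S f | f in dom T] v)); last first.
  by apply/(si_closureP ipP); exists (fun n => S (t n)) => // n; exists (t n).
move=> _ [f Tf <-] e /(Fcore f Tf)[g [c gE] fg]; exists (feature_comb k c).
  by exists c.
have Tg : dom T g by apply: (adm_span hT); exists c.
have Scg : S g = feature_comb k c %[ae nu].
  by rewrite gE; exact: (sqrt_feature_comb c).2.
rewrite -/(sqn _).
rewrite -(_ : sqn (S f - S g) = sqn (S f - feature_comb k c)); last first.
  apply: sqn_ae; apply: filterS Scg => z Sgz _.
  by rewrite !L2_addE !L2_oppE Sgz.
have [Tfg _] := app_sub Tf Tg.
rewrite -(sqn_ae (app_sub (dom_sqrt Tf) (dom_sqrt Tg)).2).
rewrite /sqn ip_sqrt//; last exact: dom_sqrt.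
(* Of the form norm in the core hypothesis only the [T] part is kept. *)
by apply: le_lt_trans fg; rewrite lerDr; exact: (si_ge0 ipP).
Qed.

Lemma closure_ran_sqrt : form_core Fspan T -> L2_closure (ran S) = M.
Proof.
move=> /ran_sqrt_sub_closure ranM; apply/seteqP; split.
  exact: (si_closure_min ipP).
apply: (si_closure_min ipP) => _ [c _ <-]; apply: (sub_si_closure ipP).
exists (\sum_(p <- c) p.1 *: chi p.2); exact: sqrt_feature_comb.
Qed.

Lemma L2_complete_closure_ran :
  L2_complete (ran S) -> L2_closure (ran S) = ran S.
Proof.
move=> Sc; apply/seteqP; split; last exact: (sub_si_closure ipP).
move=> g /(si_closureP ipP)[u Su ug].
have [f Sf uf] := Sc u Su (si_cvg_cauchy ipP ug).
apply: (ran_ae Sf); apply/ae_eqP.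
(* Both limits of [u] are subtracted: the zero sequence converges to [f - g], which is therefore
   null. *)
have := si_cvg_lin ipP (-1) ug uf.
under eq_fun do rewrite scaleN1r addNr.
rewrite scaleN1r addrC /si_cvg.
under eq_fun do rewrite sub0r (siNl ipP) (siNr ipP) opprK.
by move=> /(cvg_lim (@Rhausdorff R)); rewrite lim_cst.
Qed.

End FriedrichsSquareRoot.

Theorem theorem7p6 (R : realType) (d : measure_display) (X : measurableType d)
    (nu : {sigma_finite_measure set X -> \bar R})
    (hX : standard_borel R X)
    (T That S : operator nu)
    (hT : admissible T)
    (hThat : friedrichs_extension T That)
    (hS : is_sqrt S That)
    (lambda : {measure set (X * X) -> \bar R})
    (hlambda : is_symmetric_measure_of T lambda) :
  let K : Dfin nu -> Dfin nu -> R := kernel_of lambda in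
  [/\ positive_definite K,
      reproducing_space K (rkhs K) (rkhs_ip K),
      (forall F, rkhs K F -> signed_measure_on F /\ abs_continuous F),
      [/\ forall f, dom S f ->
            rkhs K (hat T f) /\ forall A, hat T f A = ip (T (chi A)) f,
          forall F, rkhs K F -> forall e : R, 0 < e ->
            exists2 f, dom S f & rkhs_norm K (F \- hat T f) < e,
          forall f, dom S f ->
            (exists h, pointwise_action T f h) /\
            (forall h, pointwise_action T f h -> has_density (hat T f) h),
          forall f, dom T f -> has_density (hat T f) (T f)
        & forall f, dom That f -> has_density (hat T f) (That f)]
    & form_core (@Fspan _ _ _ nu) T ->
      (forall f, dom S f -> L2norm (S f) = rkhs_norm K (hat T f)) /\
      exists Phi : L2 nu -> Dfin nu -> R,
        [/\ forall f, dom S f -> Phi (S f) = hat T f,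
            isometric_isomorphism (L2_closure (ran S)) (rkhs K) (rkhs_ip K) Phi
          & L2_complete (ran S) ->
            rkhs K = [set hat T f | f in dom S] /\
            isometric_isomorphism (ran S) (rkhs K) (rkhs_ip K) Phi]].
Proof.
move=> K.
have ipP := ip_semi_inner nu; have L2c := @L2_si_complete _ X R nu.
pose k := sqrt_chi S.
have KE A B : K A B = ip (k A) (k B) by exact: (kernel_ofE hT hThat hS hlambda).
have hE f : dom S f -> hat T f = feature_eval (@ip _ _ _ nu) k (S f).
  by move=> Sf; rewrite (hatE hT hThat hS Sf).
have rkP := rkhsP ipP L2c KE.
split.
- exact: (gram_positive_definite ipP KE).
- exact: (gram_reproducing_space ipP L2c KE).
- move=> F /rkP[g _ ->]; split.
    exact: (feature_eval_signed_measure hT hThat hS hlambda).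
  exact: (feature_eval_abs_continuous hT hThat hS).
- split.
  + move=> f Sf; split=> //; rewrite hE//.
    (* Without the core hypothesis [S f] may lie outside [M], so its projection is used. *)
    have [m Mm ->] := feature_eval_rkhs_proj ipP L2c k (S f).
    exact: (feature_eval_rkhs ipP L2c KE).
  + move=> F /rkP[g Mg ->] e e0.
    (* Closures are measured in squared norm, hence [e ^+ 2]; the approximating combination is [S]
       of a simple function, almost everywhere. *)
    have [|_ [c _ <-] gc] := Mg (e ^+ 2); first by rewrite exprn_gt0.
    have [Sc cE] := sqrt_feature_comb hT hThat hS c.
    exists (\sum_(p <- c) p.1 *: chi p.2) => //; rewrite hE//.
    rewrite (_ : feature_eval _ _ (S _) =
        feature_eval (@ip _ _ _ nu) k (feature_comb k c)).
      have Mgc := feature_closureB ipP Mg (feature_combM ipP k c).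
      rewrite -(feature_evalB ipP) /rkhs_norm /rkhs_sqn.
      rewrite (rkhs_ipE ipP L2c KE Mgc Mgc).
      by rewrite -[e]ger0_norm ?ltW// -sqrtr_sqr ltr_sqrt// exprn_gt0.
    by apply/funext => A; exact: ip_ae.
  + move=> f _; split; first exact: pointwise_action_exists.
    by move=> h; exact: pointwise_action_density.
  + move=> f Tf; rewrite (_ : hat T f = fun A => ip (chi A) (T f)).
      exact: has_density_chi.
    by apply/funext => A; rewrite (ip_chi_app hT).
  + move=> f Thatf; rewrite (_ : hat T f = fun A => ip (chi A) (That f)).
      exact: has_density_chi.
    (* The Friedrichs extension is a restriction of the adjoint of [T], which moves the operator
       from [chi A] to [f]. *)
    have [_ adj] := (hThat f (That f)).1 (graph_app Thatf).
    by apply/funext => A; apply: adj; exact: chi_dom.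
- move=> Fcore; have ranM := ran_sqrt_sub_closure hT hThat hS Fcore.
  have SM f : dom S f -> feature_closure (@ip _ _ _ nu) k (S f).
    by move=> Sf; apply: ranM; exists f; exact: graph_app.
  split=> [f Sf|].
    rewrite hE// /rkhs_norm /rkhs_sqn (rkhs_ipE ipP L2c KE)//; exact: SM.
  have iso : isometric_isomorphism (L2_closure (ran S)) (rkhs K) (rkhs_ip K)
      (feature_eval (@ip _ _ _ nu) k).
    rewrite (closure_ran_sqrt hT hThat hS Fcore); split.
    + by move=> g Mg; exact: (feature_eval_rkhs ipP L2c KE).
    + by move=> a g h _ _; exact: (feature_eval_lin ipP).
    + by move=> g h Mg Mh; exact: (rkhs_ipE ipP L2c KE Mg Mh).
    + move=> g h Mg Mh; split=> [gh|/ae_eqP].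
        by apply/ae_eqP; exact: (feature_eval_inj ipP Mg Mh gh).
      exact: (feature_eval_eq ipP).
    + by move=> F /rkP[g Mg ->]; exists g.
  exists (feature_eval (@ip _ _ _ nu) k); split=> [f Sf||Sc].
  + by rewrite hE.
  + exact: iso.
  + rewrite -(L2_complete_closure_ran Sc); split; last exact: iso.
    apply/seteqP; split=> [F /(iso_onto iso)[g]|_ [f Sf <-]]; last first.
      by rewrite hE//; apply/rkP; exists (S f) => //; exact: SM.
    rewrite (L2_complete_closure_ran Sc) => -[f [Sf Sfg]] <-.
    by exists f => //; rewrite hE//; apply/funext => A; exact: ip_ae.
Qed.
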